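(* Let $n,k_1,k_2,t$ be positive integers with $k_1\ge k_2\ge t+1$ and $n\ge k_1+k_2+t+7$. Suppose that $\mathcal{F}_1\subseteq\mathcal{M}(k_1,n)$ and $\mathcal{F}_2\subseteq\mathcal{M}(k_2,n)$ are non-trivial cross $t$-intersecting families such that $|\mathcal{F}_1|\cdot|\mathcal{F}_2|$ is maximum among all pairs of non-trivial cross $t$-intersecting families $\mathcal{F}_1\subseteq\mathcal{M}(k_1,n)$, $\mathcal{F}_2\subseteq\mathcal{M}(k_2,n)$. (1) If $k_2>2t$, then there exist a $(k_2+1)$-flat $M$ and a $t$-flat $T\subseteq M$ such that either (i) $\mathcal{F}_1=\mathcal{A}_1(M,T;k_1,t)$ and $\mathcal{F}_2=\mathcal{A}_2(M,T;k_2,t)$; or (ii) $k_1=k_2$ and $\mathcal{F}_1=\mathcal{A}_2(M,T;k_1,t)$, $\mathcal{F}_2=\mathcal{A}_1(M,T;k_2,t)$. (2) If $k_2\le 2t$, then there exists a $(t+1)$-flat $S$ such that either (i) $\mathcal{F}_1=\mathcal{A}_3(S;k_1)$ and $\mathcal{F}_2=\mathcal{A}_4(S;k_2,t)$; or (ii) $k_1=k_2$ and $\mathcal{F}_1=\mathcal{A}_4(S;k_1,t)$, $\mathcal{F}_2=\mathcal{A}_3(S;k_2)$.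
   Context: $q$ is a prime power and $AG(n,\mathbb{F}_q)$ is the $n$-dimensional affine space over $\mathbb{F}_q$: a $k$-flat is a coset $P+x$ of a $k$-dimensional subspace $P$ of $\mathbb{F}_q^n$, of dimension $\dim P$. $\mathcal{M}(k,n)$ is the set of all $k$-flats, and for a flat $A$, $\mathcal{M}(a,A)=\{F\in\mathcal{M}(a,n):F\subseteq A\}$. The intersection of two flats is a flat or empty; the empty set is regarded as having dimension smaller than every nonnegative integer. Families $\mathcal{F}_1\subseteq\mathcal{M}(k_1,n)$, $\mathcal{F}_2\subseteq\mathcal{M}(k_2,n)$ are cross $t$-intersecting if $\dim(F_1\cap F_2)\ge t$ for all $F_1\in\mathcal{F}_1,F_2\in\mathcal{F}_2$; they are trivial if some $t$-flat is contained in every member of $\mathcal{F}_1$ and of $\mathcal{F}_2$, and non-trivial otherwise. For a $(k_2+1)$-flat $M$, a $t$-flat $T\subseteq M$, a $(t+1)$-flat $S$ and a positive integer $k$: $\mathcal{A}_1(M,T;k,t)=\{F\in\mathcal{M}(k,n):T\subseteq F,\ \dim(F\cap M)\ge t+1\}$, $\mathcal{A}_2(M,T;k,t)=\{F\in\mathcal{M}(k,n):T\subseteq F\}\cup\{F\in\mathcal{M}(k,M):\dim(F\cap T)=t-1\}$, $\mathcal{A}_3(S;k)=\{F\in\mathcal{M}(k,n):S\subseteq F\}$, $\mathcal{A}_4(S;k,t)=\{F\in\mathcal{M}(k,n):\dim(F\cap S)\ge t\}$. *)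

(* Defs.v *)
From HB Require Import structures.
From mathcomp Require Import all_boot all_order all_algebra.

Set Implicit Arguments.
Unset Strict Implicit.
Unset Printing Implicit Defensive.

Import Order.TTheory GRing.Theory Num.Theory.

Section Flats.

Variables (F : finFieldType) (n : nat).
Implicit Types (A B M S T : {set 'rV[F]_n}) (G H : {set {set 'rV[F]_n}}).
Implicit Types (k t : nat).

(* A linear subspace is represented as the row space of some P : 'M_n. *)
Definition affine_coset (P : 'M[F]_n) (x : 'rV[F]_n) : {set 'rV[F]_n} :=
  [set (v + x)%R | v : 'rV[F]_n & (v <= P)%MS].

Definition flats k : {set {set 'rV[F]_n}} :=
  [set A | [exists P : 'M[F]_n, exists x,
    (\rank P == k) && (A == affine_coset P x)]].

Definition flats_in k A : {set {set 'rV[F]_n}} :=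
  [set B in flats k | B \subset A].

(* The value -1 is only a stand-in for sets that are not flats, in particular *)
(* for the empty set, whose dimension is below every nonnegative integer.     *)
Definition flat_dim A : int :=
  if [pick k : 'I_n.+1 | A \in flats k] is Some k then k%:Z else (-1)%R.

Definition cross_intersecting t G H : Prop :=
  forall A B, A \in G -> B \in H -> (t%:Z <= flat_dim (A :&: B))%R.

Definition trivial_pair t G H : Prop :=
  exists2 T, T \in flats t &
    (forall A, A \in G -> T \subset A) /\ (forall B, B \in H -> T \subset B).

Definition nontrivial_cross_intersecting k1 k2 t G H : Prop :=
  [/\ G \subset flats k1, H \subset flats k2,
      cross_intersecting t G H & ~ trivial_pair t G H].

Definition famA1 M T k t : {set {set 'rV[F]_n}} :=
  [set A in flats k | (T \subset A) && (t.+1%:Z <= flat_dim (A :&: M))%R].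

Definition famA2 M T k t : {set {set 'rV[F]_n}} :=
  [set A in flats k | T \subset A]
    :|: [set A in flats_in k M | flat_dim (A :&: T) == (t%:Z - 1)%R].

Definition famA3 S k : {set {set 'rV[F]_n}} :=
  [set A in flats k | S \subset A].

Definition famA4 S k t : {set {set 'rV[F]_n}} :=
  [set A in flats k | (t%:Z <= flat_dim (A :&: S))%R].

Lemma mem_affine_coset P x v : (v \in affine_coset P x) = ((v - x)%R <= P)%MS.
Proof.
apply/imsetP/idP => [[w]|vP]; first by rewrite inE => wP ->; rewrite addrK.
by exists (v - x)%R; rewrite ?inE ?subrK.
Qed.

Lemma affine_coset_rank (P Q : 'M[F]_n) x y :
  affine_coset P x = affine_coset Q y -> \rank P = \rank Q.
Proof.
have sub (P1 Q1 : 'M[F]_n) x1 y1 : affine_coset P1 x1 = affine_coset Q1 y1 -> (P1 <= Q1)%MS.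
  move=> e; apply/rV_subP => v vP.
  have xQ : ((x1 - y1)%R <= Q1)%MS by rewrite -mem_affine_coset -e mem_affine_coset subrr sub0mx.
  have : ((v + x1 - y1)%R <= Q1)%MS by rewrite -mem_affine_coset -e mem_affine_coset addrK.
  by rewrite -addrA => h; rewrite -(addrK (x1 - y1)%R v) addmx_sub ?eqmx_opp.
move=> e; apply/eqP; rewrite eqn_leq (mxrankS (sub _ _ _ _ e)).
exact: mxrankS (sub _ _ _ _ (esym e)).
Qed.

Lemma flat_dimE A k : A \in flats k -> flat_dim A = k%:Z%R.
Proof.
move=> Ak; have := Ak; rewrite inE => /existsP[P /existsP[x /andP[/eqP rP /eqP eA]]].
rewrite /flat_dim; case: pickP => [j|/(_ (inord k))].
  rewrite inE => /existsP[Q /existsP[y /andP[/eqP rQ /eqP eB]]].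
  by rewrite -rP -rQ; congr Posz; apply: (@affine_coset_rank _ _ y x); rewrite -eB -eA.
by rewrite inordK ?Ak // ltnS -rP rank_leq_row.
Qed.

Lemma flat_dim0 : flat_dim set0 = (-1)%R.
Proof.
rewrite /flat_dim; case: pickP => // j; rewrite inE.
case/existsP=> P /existsP[x /andP[_ /eqP /setP/(_ x)]].
by rewrite mem_affine_coset subrr sub0mx inE.
Qed.

End Flats.

Arguments flats {F n} k.

(* Main.v *)
Require Import Defs.
From HB Require Import structures.
From mathcomp Require Import all_boot all_order all_algebra.
From mathcomp Require Import zify ring lra.

(* Flats are measured by their number of points, so that [dim (A :&: B) >= t]     *)
(* reads [q ^ t <= #|A :&: B|]. A flat covers a family when it meets every member *)
(* in dimension at least [t]; let [t + x] and [t + y] be the least dimensions of  *)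
(* flats covering F1 and F2. If an s-flat S does not cover F2, some member X of   *)
(* F2 meets S in few points, and counting the points of [X :\: S] on the members  *)
(* of F1 through S bounds their number by [k2 - t + 1]_q times the number of      *)
(* members of F1 through an (s+1)-flat. Starting from the t-flats of a least      *)
(* cover of F1 and climbing to dimension [t + y] gives                            *)
(*   |F1| <= q^x [t + x, t]_q [k2 - t + 1]_q^y [n - t - y, k1 - t - y]_q,         *)
(* and symmetrically for F2. For [x + y >= 2] the product of the two bounds is    *)
(* below |A1||A2| as soon as [n >= k1 + k2 + t + 7]. For [x = y = 0] the pair is  *)
(* trivial. For [x = 0], [y = 1] all members of F1 share a t-flat T, and every    *)
(* (t+1)-flat covering F2 contains T and lies in the span of T and B, for each B  *)
(* in F2 not containing T. A single such cover S leads to (A3, A4); covers whose  *)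
(* spans all agree lead to (A1, A2); all other configurations are too small.      *)
(* Comparing the model pairs with each other settles which of them is maximum.   *)

Set Implicit Arguments.
Unset Strict Implicit.
Unset Printing Implicit Defensive.

Import Order.TTheory GRing.Theory Num.Theory.

(** Why these pairs are extremal: with N(k,s) for [nnum k s], the number of k-flats through an
    s-flat, one more prescribed dimension divides N(k,s) by at least q^(n-k). A large product
    therefore needs covers of the least possible dimension, and non-triviality leaves x + y = 1 as
    the best case. Say all of F1 passes through a t-flat [T]; the product is then about c N(k,t+1)
    N(l,t), with k = k1 and l = k2. For (A1, A2) the constant c is [l-t+1]_q; for (A3, A4) it is q
    [t+1]_q = [t+2]_q - 1. Comparing l - t + 1 with t + 2 gives the threshold l = 2t + 1.

    [sup_noncover_le] and [chain_cover] supply the upper bounds. [far_families] discards x + y >= 2.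
    [one_center_families] handles x + y = 1, with the closure property of a maximum pair from
    [maximum_closed] as input. [fam12_lt_fam34] and [fam34_lt_fam12] decide between the two models,
    and [fam12_swap_lt] and [fam34_swap_lt] rule out exchanged roles unless k1 = k2. *)

Ltac clear_nonarith :=
  repeat match goal with
  | H : context [@mem] |- _ => clear H
  | H : context [@Order.le] |- _ => clear H
  | H : context [@Order.lt] |- _ => clear H
  | H : @eq (GRing.PzRing.sort _) _ _ |- _ => clear H
  end.
Ltac nlia := clear_nonarith; lia.
Ltac nnia := clear_nonarith; nia.

(** * Affine flats: sizes, spans, chains and intersections *)

Section Geometry.
Variables (F : finFieldType) (n : nat).
Local Notation V := 'rV[F]_n.
Local Notation q := #|F|.
Implicit Types (A B M S T X : {set V}) (x y z : V).

Lemma q_gt1 : 1 < q.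
Proof. exact: card_finNzRing_gt1. Qed.

Lemma q_gt0 : 0 < q.
Proof. exact: ltnW q_gt1. Qed.

Lemma expq_gt0 k : 0 < q ^ k.
Proof. by rewrite expn_gt0 q_gt0. Qed.

Definition flat A := [exists k : 'I_n.+1, A \in flats k].

Lemma flats_based A k x : A \in flats k -> x \in A ->
  exists2 P : 'M[F]_n, \rank P = k & A = affine_coset P x.
Proof.
rewrite inE => /existsP[P /existsP[x0 /andP[/eqP rP /eqP ->]]].
rewrite mem_affine_coset => xP; exists P => //.
apply/setP=> v; rewrite !mem_affine_coset.
have -> : (v - x0 = (v - x) + (x - x0))%R by rewrite addrA subrK.
apply/idP/idP => h; last exact: addmx_sub.
by rewrite -(addrK (x - x0)%R (v - x)%R) addmx_sub ?eqmx_opp.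
Qed.

Lemma affine_coset_flats (P : 'M[F]_n) x : affine_coset P x \in flats (\rank P).
Proof. by rewrite inE; apply/existsP; exists P; apply/existsP; exists x; rewrite !eqxx. Qed.

Lemma flats_leq A k : A \in flats k -> k <= n.
Proof.
by rewrite inE => /existsP[P /existsP[x /andP[/eqP <- _]]]; exact: rank_leq_row.
Qed.

Lemma flats_flat A k : A \in flats k -> flat A.
Proof.
move=> Ak; have kn := flats_leq Ak; apply/existsP; exists (inord k).
by rewrite inordK.
Qed.

Lemma flatP A : reflect (exists k, A \in flats k) (flat A).
Proof.
apply: (iffP existsP) => [[k Ak]|[k Ak]]; first by exists k.
exact/existsP/(flats_flat Ak).
Qed.

Lemma card_flats A k : A \in flats k -> #|A| = q ^ k.
Proof.
rewrite inE => /existsP[P /existsP[x /andP[/eqP <- /eqP ->]]].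
rewrite card_imset; last exact: addIr.
transitivity #|[set (w *m row_base P)%R | w : 'rV[F]_(\rank P)]|.
  apply: eq_card => v; rewrite inE; apply/idP/imsetP => [|[w _ ->]].
    by rewrite -(eq_row_base P) => /submxP[w ->]; exists w.
  by rewrite (submx_trans (submxMl _ _)) ?eq_row_base.
rewrite card_imset; first by rewrite card_mx mul1n.
exact/row_free_inj/row_base_free.
Qed.

Lemma flats_dim_inj A k l : A \in flats k -> A \in flats l -> k = l.
Proof.
move=> /card_flats Ak /card_flats; rewrite Ak => /eqP.
by rewrite (inj_eq (expnI q_gt1)) => /eqP.
Qed.

Lemma flats_point A k : A \in flats k -> exists x, x \in A.
Proof.
by move=> /card_flats Ak; apply/set0Pn; rewrite -card_gt0 Ak expq_gt0.
Qed.

Lemma flats_leq_sub A B k l : A \in flats k -> B \in flats l -> A \subset B -> k <= l.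
Proof.
move=> /card_flats Ak /card_flats Bl /subset_leq_card.
by rewrite Ak Bl leq_exp2l ?q_gt1.
Qed.

Lemma flats_sub_eq A B k : A \in flats k -> B \in flats k -> A \subset B -> A = B.
Proof.
by move=> /card_flats Ak /card_flats Bk AB; apply/eqP; rewrite eqEcard AB Ak Bk leqnn.
Qed.

Lemma flat_line A x y z (c : F) : flat A -> x \in A -> y \in A -> z \in A ->
  (z + c *: (y - x))%R \in A.
Proof.
case/flatP=> k Ak xA; case: (flats_based Ak xA) => P _ ->.
rewrite !mem_affine_coset => yP zP; rewrite addrAC.
by apply: addmx_sub => //; apply: scalemx_sub.
Qed.

Lemma flat_lineN A x y z (c : F) : flat A -> x \in A -> y \in A -> z \in A ->
  (z - c *: (y - x))%R \in A.
Proof. by move=> *; rewrite -scaleNr; apply: flat_line. Qed.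

Lemma flatI A B x : flat A -> flat B -> x \in A -> x \in B -> flat (A :&: B).
Proof.
case/flatP=> k Ak /flatP[l Bl] xA xB.
have [P _ eA] := flats_based Ak xA; have [Q _ eB] := flats_based Bl xB.
apply/flatP; exists (\rank (P :&: Q)%MS).
suff -> : A :&: B = affine_coset (P :&: Q)%MS x by exact: affine_coset_flats.
by apply/setP=> v; rewrite inE eA eB !mem_affine_coset sub_capmx.
Qed.

Lemma setT_flats : [set: V] \in flats n.
Proof.
suff <- : affine_coset (1%:M : 'M[F]_n)%R 0%R = setT.
  by have := affine_coset_flats (1%:M : 'M[F]_n)%R 0%R; rewrite mxrank1.
by apply/setP=> v; rewrite mem_affine_coset submx1 inE.
Qed.

Lemma set1_flats x : [set x] \in flats 0.
Proof.
suff <- : affine_coset (0%R : 'M[F]_n) x = [set x].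
  by have := affine_coset_flats (0%R : 'M[F]_n) x; rewrite mxrank0.
by apply/setP=> v; rewrite mem_affine_coset submx0 subr_eq0 inE.
Qed.

Definition aff_hull X := \bigcap_(A | flat A && (X \subset A)) A.

Lemma sub_aff_hull X : X \subset aff_hull X.
Proof. by apply/bigcapsP => A /andP[]. Qed.

Lemma aff_hull_min X A : flat A -> X \subset A -> aff_hull X \subset A.
Proof. by move=> fA XA; apply: bigcap_inf; rewrite fA. Qed.

(** Defined through an intersection of flats, so that [join set0 y] makes sense too; [chain_cover]
    starts its count from the empty set. *)
Definition join A y := aff_hull (y |: A).

Lemma join_mem A y : y \in join A y.
Proof. by apply: (subsetP (sub_aff_hull _)); rewrite setU11. Qed.

Lemma sub_join A y : A \subset join A y.
Proof. by apply: subset_trans (sub_aff_hull _); rewrite subsetUr. Qed.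

Lemma join_sub A B y : flat B -> (join A y \subset B) = (y \in B) && (A \subset B).
Proof.
move=> fB; apply/idP/andP => [jB|[yB AB]].
  by rewrite (subsetP jB) ?join_mem // (subset_trans (sub_join _ _) jB).
by apply: aff_hull_min => //; rewrite subUset sub1set yB.
Qed.

Lemma join_coset (P : 'M[F]_n) x y :
  join (affine_coset P x) y = affine_coset (P + (y - x)%R)%MS x.
Proof.
have sA : affine_coset P x \subset affine_coset (P + (y - x)%R)%MS x.
  apply/subsetP=> w; rewrite !mem_affine_coset => h.
  exact: submx_trans h (addsmxSl _ _).
apply/eqP; rewrite eqEsubset; apply/andP; split.
  apply: aff_hull_min; first by apply: flats_flat (affine_coset_flats _ _).
  by rewrite subUset sub1set mem_affine_coset addsmxSr.
apply/bigcapsP => B /andP[fB]; rewrite subUset sub1set => /andP[yB AB].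
apply/subsetP=> w; rewrite mem_affine_coset => /sub_addsmxP[[u1 u2] /= e].
have xA : x \in affine_coset P x by rewrite mem_affine_coset subrr sub0mx.
have xB := subsetP AB _ xA.
have -> : w = ((u1 *m P + x) + (u2 ord0 ord0) *: (y - x))%R.
  rewrite -(subrK x w) e {1}(mx11_scalar u2) mul_scalar_mx.
  by rewrite addrAC.
apply: flat_line => //; apply: (subsetP AB).
by rewrite mem_affine_coset addrK submxMl.
Qed.

Lemma mem_join A x y v : flat A -> x \in A ->
  v \in join A y <-> exists c : F, (v - c *: (y - x))%R \in A.
Proof.
case/flatP=> k Ak xA; have [P _ ->] := flats_based Ak xA.
rewrite join_coset mem_affine_coset; split => [/sub_addsmxP[[u1 u2] /= e]|[c]].
  exists (u2 ord0 ord0); rewrite mem_affine_coset addrAC e.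
  by rewrite {1}(mx11_scalar u2) mul_scalar_mx addrK submxMl.
rewrite mem_affine_coset => /submxP[D e]; apply/sub_addsmxP; exists (D, c%:M%R) => /=.
by rewrite -e mul_scalar_mx addrAC subrK.
Qed.

Lemma join_flats A k y : A \in flats k -> y \notin A -> join A y \in flats k.+1.
Proof.
move=> Ak; have [x xA] := flats_point Ak.
have [P rP ->] := flats_based Ak xA; rewrite mem_affine_coset join_coset => yP.
have <- : \rank (P + (y - x)%R)%MS = k.+1; last exact: affine_coset_flats.
apply/eqP; rewrite eqn_leq; apply/andP; split.
  rewrite -rP -(addn1 (\rank P)); apply: leq_trans (mxrank_adds_leqif _ _).1 _.
  by rewrite leq_add2l rank_leq_row.
rewrite -rP; suff: (P < P + (y - x)%R)%MS by rewrite ltmxErank => /andP[].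
by rewrite ltmxE addsmxSl addsmx_sub submx_refl.
Qed.

Lemma join_eq A B k y : A \in flats k -> B \in flats k.+1 -> A \subset B ->
  y \in B -> y \notin A -> join A y = B.
Proof.
move=> Ak Bk AB yB yA; apply: (@flats_sub_eq _ _ k.+1) => //; first exact: join_flats.
by rewrite join_sub ?yB // (flats_flat Bk).
Qed.

Lemma flats_proper_point A B k l : A \in flats k -> B \in flats l -> k < l ->
  exists2 y, y \in B & y \notin A.
Proof.
move=> /card_flats Ak /card_flats Bl kl; apply/subsetPn.
apply/negP => /subset_leq_card; rewrite Ak Bl leq_exp2l ?q_gt1 //.
by rewrite leqNgt kl.
Qed.

Lemma flats_between A B k l m : A \in flats k -> B \in flats l -> A \subset B ->
  k <= m <= l -> exists C, [/\ C \in flats m, A \subset C & C \subset B].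
Proof.
move=> Ak Bl AB; elim: m => [|m IH] /andP[km ml].
  by move: km; rewrite leqn0 => /eqP k0; rewrite k0 in Ak; exists A.
move: km; rewrite leq_eqVlt => /orP[/eqP <-|km]; first by exists A.
have [|C [Cm AC CB]] := IH; first by rewrite -ltnS km ltnW.
have [y yB yC] := flats_proper_point Cm Bl ml.
exists (join C y); split; first exact: join_flats.
  exact: subset_trans AC (sub_join _ _).
by rewrite join_sub ?yB // (flats_flat Bl).
Qed.

(** The flat grows one point [y] at a time, with [y] taken outside [join C x]: if [x] fell into
    [join C y], that flat would equal [join C x] and contain [y]. *)
Lemma flats_avoid A B k l m x : A \in flats k -> B \in flats l -> A \subset B ->
  x \in B -> x \notin A -> k <= m < l ->
  exists C, [/\ C \in flats m, A \subset C, C \subset B & x \notin C].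
Proof.
move=> Ak Bl AB xB xA; elim: m => [|m IH] /andP[km ml].
  by move: km; rewrite leqn0 => /eqP k0; rewrite k0 in Ak; exists A.
move: km; rewrite leq_eqVlt => /orP[/eqP <-|km]; first by exists A.
have [|C [Cm AC CB xC]] := IH; first by rewrite -ltnS km ltnW.
have Cx := join_flats Cm xC.
have [y yB yC] := flats_proper_point Cx Bl ml.
have yC' : y \notin C by apply: contra yC; apply/subsetP/sub_join.
exists (join C y); split; first exact: join_flats.
- exact: subset_trans AC (sub_join _ _).
- by rewrite join_sub ?yB // (flats_flat Bl).
- apply: contra yC => xj; rewrite (join_eq Cm _ (sub_join _ _) xj) ?join_mem //.
  exact: join_flats.
Qed.

(** An empty intersection fits as well: it has dimension -1 and no points, which is below k and
    below q^k. *)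
Lemma flat_capP A B k : flat A -> flat B ->
  ((k%:Z <= flat_dim (A :&: B))%R = (q ^ k <= #|A :&: B|)).
Proof.
move=> fA fB; have [e|[x]] := set_0Vmem (A :&: B).
  by rewrite e flat_dim0 cards0 leqNgt expq_gt0.
rewrite inE => /andP[xA xB]; have /flatP[m fI] := flatI fA fB xA xB.
by rewrite (flat_dimE fI) (card_flats fI) leq_exp2l ?q_gt1.
Qed.

Lemma flat_cap_eqP A B k : flat A -> flat B ->
  (flat_dim (A :&: B) == k%:Z%R) = (#|A :&: B| == q ^ k).
Proof.
move=> fA fB; have [e|[x]] := set_0Vmem (A :&: B).
  by rewrite e flat_dim0 cards0 (ltn_eqF (expq_gt0 _)).
rewrite inE => /andP[xA xB]; have /flatP[m fI] := flatI fA fB xA xB.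
by rewrite (flat_dimE fI) (card_flats fI) (inj_eq (expnI q_gt1)).
Qed.

(** Either [Z] lies in the hyperplane [A] of [B], or [Z] is spanned by [Z :&: A] and one point off
    [A]. The common point excludes a [Z] parallel to [A]. *)
Lemma hyperplane_cap A B Z k : A \in flats k -> B \in flats k.+1 -> A \subset B ->
  flat Z -> Z \subset B -> A :&: Z != set0 -> #|Z| <= q * #|Z :&: A|.
Proof.
move=> Ak Bk AB fZ ZB /set0Pn[x]; rewrite inE => /andP[xA xZ].
have fA := flats_flat Ak.
have [ZA|/subsetPn[y yZ yA]] := boolP (Z \subset A).
  by rewrite (setIidPl ZA) leq_pmull ?q_gt0.
have /flatP[m Im] := flatI fZ fA xZ xA.
have yI : y \notin Z :&: A by rewrite inE yZ.
have := card_flats (join_flats Im yI); rewrite expnS -(card_flats Im) => <-.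
apply: subset_leq_card; apply/subsetP => z zZ.
have xI : x \in Z :&: A by rewrite inE xZ.
have eB := join_eq Ak Bk AB (subsetP ZB _ yZ) yA.
have : z \in join A y by rewrite eB (subsetP ZB).
case/(mem_join _ _ fA xA) => c h; apply/(mem_join _ _ (flats_flat Im) xI).
by exists c; rewrite inE h flat_lineN.
Qed.

End Geometry.

(** * Counting flats by double counting of incident points *)

Section Counting.
Context {R : realFieldType}.
Variables (F : finFieldType) (n : nat).
Local Notation V := 'rV[F]_n.
Local Notation q := #|F|.
Local Notation Q := (#|F|%:R%R : R).
Implicit Types (A B M S T X : {set V}) (y z : V) (G : {set {set V}}).
Local Open Scope ring_scope.

Lemma Q_ge2 : 2 <= Q.
Proof. by rewrite (ler_nat _ 2) (q_gt1 F). Qed.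

Lemma Q_gt0 : 0 < Q.
Proof. by rewrite ltr0n (q_gt0 F). Qed.

Lemma expQ_gt0 k : 0 < Q ^+ k.
Proof. exact: exprn_gt0 Q_gt0. Qed.

Lemma expQ_lt j k : (j < k)%N -> Q ^+ j < Q ^+ k.
Proof. by move=> jk; rewrite -!natrX ltr_nat ltn_exp2l // (q_gt1 F). Qed.

Lemma expQ_le j k : (j <= k)%N -> Q ^+ j <= Q ^+ k.
Proof. by move=> jk; rewrite -!natrX ler_nat leq_exp2l // (q_gt1 F). Qed.

(** The q-number [m]_q = (q^m - 1) / (q - 1). *)
Definition gnum m : R := \sum_(i < m) Q ^+ i.

Lemma gnumE m : (Q - 1) * gnum m = Q ^+ m - 1.
Proof. by rewrite subrX1. Qed.

Lemma gnumS m : gnum m.+1 = gnum m + Q ^+ m.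
Proof. by rewrite /gnum big_ord_recr. Qed.

Lemma gnum_ge0 m : 0 <= gnum m.
Proof. by apply: sumr_ge0 => i _; rewrite exprn_ge0 // ltW // Q_gt0. Qed.

Lemma gnum_lt m : gnum m < Q ^+ m.
Proof.
elim: m => [|m IH]; first by rewrite /gnum big_ord0 expr0.
rewrite gnumS exprS; have := Q_ge2; have := expQ_gt0 m; nra.
Qed.

Lemma gnum_leS m k : (m <= k)%N -> gnum m <= gnum k.
Proof.
move=> /subnK <-; elim: (k - m)%N => [|d IH] //.
by rewrite addSn gnumS (le_trans IH) // lerDl ltW // expQ_gt0.
Qed.

Definition sup G S := [set A in G | S \subset A].

Lemma in_sup G S A : (A \in sup G S) = (A \in G) && (S \subset A).
Proof. by rewrite inE. Qed.

Lemma sum_card_cap G X :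
  (\sum_(A in G) #|A :&: X| = \sum_(y in X) #|[set A in G | y \in A]|)%N.
Proof.
under eq_bigr do rewrite -sum1_card.
under [RHS]eq_bigr do rewrite -sum1_card.
rewrite (exchange_big_dep (mem X)) /=; last by move=> A y _; rewrite inE => /andP[].
apply: eq_bigr => y yX; apply: eq_bigl => A.
by rewrite !inE yX andbT.
Qed.

Lemma sup_join G k S y : G \subset flats k -> [set A in sup G S | y \in A] = sup G (join S y).
Proof.
move=> Gk; apply/setP=> A; rewrite !inE -andbA.
have [AG|//] := boolP (A \in G); rewrite /= join_sub 1?andbC //.
exact: flats_flat (subsetP Gk _ AG).
Qed.

Lemma card_capD S X (A : {set V}) : S \subset A -> (#|A :&: (X :\: S)| = #|A :&: X| - #|S :&: X|)%N.
Proof.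
move=> SA; rewrite setIDA cardsD; congr (_ - _)%N.
by rewrite setIAC (setIidPr SA).
Qed.

(** Double counting of the pairs of a member [A] through [S] and a point [y] of [A] in [X :\: S];
    the members through [S] and [y] are those through [join S y]. The counts below iterate this
    step. *)
Lemma sup_step_le G k S X (c m : R) : G \subset flats k ->
  (forall A, A \in G -> S \subset A -> c <= #|A :&: (X :\: S)|%:R) ->
  (forall y, y \in X -> y \notin S -> #|sup G (join S y)|%:R <= m) ->
  c * #|sup G S|%:R <= #|X :\: S|%:R * m.
Proof.
move=> Gk hc hm.
have := congr1 (fun i : nat => i%:R : R) (sum_card_cap (sup G S) (X :\: S)).
rewrite !natr_sum => e.
apply: (@le_trans _ _ (\sum_(A in sup G S) #|A :&: (X :\: S)|%:R)).
  rewrite mulr_natr -sumr_const; apply: ler_sum => A; rewrite inE => /andP[AG SA].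
  exact: hc.
rewrite e mulr_natl -sumr_const; apply: ler_sum => y; rewrite inE => /andP[yS yX].
by rewrite (sup_join _ _ Gk) hm.
Qed.

Lemma sup_step_eq G k S X (c m : R) : G \subset flats k ->
  (forall A, A \in G -> S \subset A -> #|A :&: (X :\: S)|%:R = c) ->
  (forall y, y \in X -> y \notin S -> #|sup G (join S y)|%:R = m) ->
  c * #|sup G S|%:R = #|X :\: S|%:R * m.
Proof.
move=> Gk hc hm.
have := congr1 (fun i : nat => i%:R : R) (sum_card_cap (sup G S) (X :\: S)).
rewrite !natr_sum => e.
transitivity (\sum_(A in sup G S) #|A :&: (X :\: S)|%:R : R).
  rewrite mulr_natr -sumr_const; apply: eq_bigr => A; rewrite inE => /andP[AG SA].
  by rewrite hc.
rewrite e mulr_natl -sumr_const; apply: eq_bigr => y; rewrite inE => /andP[yS yX].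
by rewrite (sup_join _ _ Gk) hm.
Qed.

Definition meet_flats k T M := [set A in flats k | A :&: M == T].

Lemma in_meet k T M A : (A \in meet_flats k T M) = (A \in flats k) && (A :&: M == T).
Proof. by rewrite inE. Qed.

(** A flat [A] containing [T] and [y] can be translated along [y - x] with [x] in [T], so each of
    its points in [join M y] comes from a point of [A :&: M]. This is the inductive step for
    [card_meet_flats]. *)
Lemma meet_join k T M t s y : T \in flats t -> M \in flats s -> T \subset M -> y \notin M ->
  [set A in meet_flats k T M | y \in A] = meet_flats k (join T y) (join M y).
Proof.
move=> Tt Ms TM yM; apply/setP=> A; rewrite inE !in_meet.
have [Ak|//] := boolP (A \in flats k); rewrite /=.
have fA := flats_flat Ak; have fT := flats_flat Tt; have fM := flats_flat Ms.
have yT : y \notin T by apply: contra yM; apply/subsetP.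
have fjT := flats_flat (join_flats Tt yT); have fjM := flats_flat (join_flats Ms yM).
have jTM : join T y \subset join M y.
  by rewrite join_sub // join_mem (subset_trans TM) ?sub_join.
apply/idP/idP => [/andP[/eqP AM yA]|/eqP AM].
  have TA : T \subset A by rewrite -AM subsetIl.
  rewrite eqEsubset subsetI jTM join_sub // yA TA /= andbT.
  apply/subsetP=> z; rewrite inE => /andP[zA].
  have [x xT] := flats_point Tt.
  case/(mem_join y z fM (subsetP TM _ xT)) => c zc.
  apply/(mem_join y z fT xT); exists c; rewrite -AM inE zc andbT.
  by apply: flat_lineN => //; apply: (subsetP TA).
have yA : y \in A.
  by have := join_mem T y; rewrite -AM inE => /andP[].
rewrite yA andbT.
have eAM : A :&: M = join T y :&: M.
  by rewrite -AM -setIA (setIidPr (sub_join M y)).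
rewrite eAM; rewrite eqEsubset subsetI sub_join TM !andbT.
apply/subsetP=> z; rewrite inE => /andP[].
have [x xT] := flats_point Tt.
case/(mem_join y z fT xT) => c zc zM.
have [c0|c0] := eqVneq c 0; first by move: zc; rewrite c0 scale0r subr0.
case/negP: yM; have xM := subsetP TM _ xT; have zcM := subsetP TM _ zc.
have -> : y = x + c^-1 *: (z - (z - c *: (y - x))).
  by rewrite subKr scalerA mulVf // scale1r addrC subrK.
exact: flat_line.
Qed.

(** The number of k-flats meeting a given s-flat M in a given t-flat T. The numerator counts
    sequences of k - t points, each outside the span of M and its predecessors; the denominator
    counts those spanning one fixed k-flat together with T. *)
Definition wnum k t s : R :=
  (\prod_(s <= j < s + (k - t)) (Q ^+ n - Q ^+ j)) / \prod_(t <= j < k) (Q ^+ k - Q ^+ j).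

Lemma card_meet_flats k T M t s : (t <= k)%N -> (s + (k - t) <= n)%N ->
  T \in flats t -> M \in flats s -> T \subset M ->
  #|meet_flats k T M|%:R = wnum k t s.
Proof.
move=> tk; move ed: (k - t)%N => d.
elim: d t s T M tk ed => [|d IH] t s T M tk ed sn Tt Ms TM.
  have {tk ed}tk : t = k by nlia.
  rewrite {t}tk in Tt *; rewrite /wnum subnn addn0 !big_geq // divr1.
  suff -> : meet_flats k T M = [set T] by rewrite cards1.
  apply/setP=> A; rewrite in_meet in_set1; apply/andP/eqP => [[Ak /eqP AM]|->].
    by apply/esym/(flats_sub_eq Tt Ak); rewrite -AM subsetIl.
  by rewrite Tt (setIidPl TM).
have tk' : (t < k)%N by nlia.
have e := congr1 (fun i : nat => i%:R : R) (sum_card_cap (meet_flats k T M) (~: M)).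
have Qt := expQ_lt tk'.
apply: (@mulfI _ (Q ^+ k - Q ^+ t)); first by rewrite subr_eq0 gt_eqF.
transitivity ((\sum_(A in meet_flats k T M) #|A :&: ~: M|)%:R : R).
  rewrite natr_sum mulr_natr -sumr_const; apply: eq_bigr => A.
  rewrite inE => /andP[Ak /eqP AM].
  have := cardsID M A; rewrite AM (card_flats Ak) (card_flats Tt) setDE => h.
  by rewrite -!natrX -h natrD addrAC subrr add0r.
rewrite e natr_sum.
transitivity (\sum_(y in ~: M) wnum k t.+1 s.+1).
  apply: eq_bigr => y; rewrite inE => yM.
  have yT : y \notin T by apply: contra yM; apply/subsetP.
  rewrite (meet_join _ Tt Ms) //; apply: IH; try nlia.
  - exact: join_flats.
  - exact: join_flats.
  - have fj := flats_flat (join_flats Ms yM).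
    by rewrite join_sub // join_mem (subset_trans TM) ?sub_join.
rewrite sumr_const.
have -> : (#|~: M| = q ^ n - q ^ s)%N.
  by rewrite cardsCs setCK (card_flats Ms) -cardsT (card_flats (setT_flats _ _)).
rewrite -(mulr_natl (wnum _ _ _)) natrB ?leq_exp2l ?(q_gt1 F) ?(flats_leq Ms) // !natrX.
rewrite /wnum [in RHS]big_ltn; last by nlia.
rewrite [X in _ = _ * (_ / X)]big_ltn //.
have -> : (s.+1 + (k - t.+1) = s + (k - t))%N by nlia.
have P0 : \prod_(t.+1 <= j < k) (Q ^+ k - Q ^+ j) != 0.
  rewrite big_seq_cond prodf_seq_neq0; apply/allP=> j; rewrite mem_index_iota => /andP[_ jk].
  by rewrite subr_eq0 (gt_eqF (expQ_lt jk)) implybT.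
by field; rewrite P0 /= subr_eq0 gt_eqF.
Qed.

(** The Gaussian binomial coefficient of n - s over k - s: the number of k-flats through an
    s-flat. *)
Definition nnum k s := wnum k s s.

Lemma sup_flatsE k S : sup (flats k) S = meet_flats k S S.
Proof. by apply/setP=> A; rewrite in_sup in_meet; congr (_ && _); apply/idP/eqP => /setIidPr. Qed.

Lemma card_sup_flats k s S : (s <= k <= n)%N -> S \in flats s ->
  #|sup (flats k) S|%:R = nnum k s.
Proof.
by move=> /andP[sk kn] Ss; rewrite sup_flatsE (card_meet_flats _ _ Ss Ss) //; nlia.
Qed.

Lemma card_sup_le k s S G : G \subset flats k -> (s <= k <= n)%N -> S \in flats s ->
  #|sup G S|%:R <= nnum k s.
Proof.
move=> Gk skn Ss; rewrite -(card_sup_flats skn Ss) ler_nat subset_leq_card //.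
by apply/subsetP=> A; rewrite !in_sup => /andP[/(subsetP Gk) -> ->].
Qed.

Lemma nnumS k s : (s < k <= n)%N ->
  (Q ^+ k - Q ^+ s) * nnum k s = (Q ^+ n - Q ^+ s) * nnum k s.+1.
Proof.
move=> /andP[sk kn]; rewrite /nnum /wnum [in LHS]big_ltn; last by nlia.
rewrite [X in _ * (_ / X) = _]big_ltn //.
have -> : (s.+1 + (k - s.+1) = s + (k - s))%N by nlia.
have P0 : \prod_(s.+1 <= j < k) (Q ^+ k - Q ^+ j) != 0.
  rewrite big_seq_cond prodf_seq_neq0; apply/allP=> j; rewrite mem_index_iota => /andP[_ jk].
  by rewrite subr_eq0 (gt_eqF (expQ_lt jk)) implybT.
by field; rewrite P0 /= subr_eq0 gt_eqF // expQ_lt.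
Qed.

Lemma nnum_gt0 k s : (s <= k <= n)%N -> 0 < nnum k s.
Proof.
move=> /andP[sk kn]; apply: divr_gt0.
  rewrite big_seq_cond; apply: prodr_gt0 => j; rewrite mem_index_iota andbT => /andP[sj jn].
  by rewrite subr_gt0 expQ_lt //; nlia.
rewrite big_seq_cond; apply: prodr_gt0 => j; rewrite mem_index_iota andbT => /andP[sj jn].
by rewrite subr_gt0 expQ_lt //; nlia.
Qed.

(** The ratio (q^n - q^s) / (q^k - q^s) from [nnumS] is at least q^(n-k). *)
Lemma nnum_decr k s : (s < k <= n)%N -> Q ^+ (n - k) * nnum k s.+1 <= nnum k s.
Proof.
move=> skn; have e := nnumS skn; case/andP: skn => sk kn.
have N0 : 0 < nnum k s.+1 by apply: nnum_gt0; rewrite sk.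
have en : Q ^+ n = Q ^+ (n - k) * Q ^+ k by rewrite -exprD subnK.
have Qs := expQ_lt sk; have Q1 := expQ_le (leq0n (n - k)); rewrite expr0 in Q1.
rewrite -(ler_pM2l (_ : 0 < Q ^+ k - Q ^+ s)) ?subr_gt0 // e mulrA.
rewrite ler_pM2r // en; have := expQ_gt0 s; nra.
Qed.

Lemma nnum_decrX k s d : (s + d <= k <= n)%N -> Q ^+ (d * (n - k)) * nnum k (s + d) <= nnum k s.
Proof.
elim: d => [|d IH] h; first by rewrite mul0n expr0 mul1r addn0.
apply: le_trans (IH _); last by nlia.
rewrite mulSn addnC exprD -mulrA ler_pM2l ?expQ_gt0 // addnS.
by apply: nnum_decr; nlia.
Qed.

(* Counting the points of [X \ S] on members of [G] through [S]. *)
Lemma sup_noncover_le G k S s X k' t (B : R) : G \subset flats k -> S \in flats s ->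
  X \in flats k' -> (0 < t <= k')%N -> (forall A, A \in G -> (q ^ t <= #|A :&: X|)%N) ->
  (#|S :&: X| < q ^ t)%N -> 0 <= B ->
  (forall Y, Y \in flats s.+1 -> S \subset Y -> #|sup G Y|%:R <= B) ->
  #|sup G S|%:R <= gnum (k' - t).+1 * B.
Proof.
move=> Gk Ss Xk /andP[t0 tk] hG SX B0 hB.
have mt : (#|S :&: X| <= q ^ t.-1)%N.
  have [->|[x]] := set_0Vmem (S :&: X); first by rewrite cards0.
  rewrite inE => /andP[xS xX].
  have /flatP[c Ic] := flatI (flats_flat Ss) (flats_flat Xk) xS xX.
  move: SX; rewrite (card_flats Ic) ltn_exp2l ?(q_gt1 F) // leq_exp2l ?(q_gt1 F) //; nlia.
set m := #|S :&: X| in SX mt.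
have cX : #|X :\: S|%:R = Q ^+ k' - m%:R.
  rewrite cardsD (card_flats Xk) setIC -/m natrB ?natrX //.
  by rewrite -(card_flats Xk) subset_leq_card ?subsetIr.
have h : (Q ^+ t - m%:R) * #|sup G S|%:R <= (Q ^+ k' - m%:R) * B.
  rewrite -cX; apply: (sup_step_le Gk) => [A AG SA|y yX yS].
    rewrite card_capD // natrB; last by apply: subset_leq_card; apply: setSI.
    by rewrite lerD2r -natrX ler_nat hG.
  apply: hB; [exact: join_flats|exact: sub_join].
(* The ratio (q^k' - m) / (q^t - m) grows with m, and at the largest value m = q^(t-1) it equals
   [k'-t+1]_q. *)
have c0 : 0 < Q ^+ t - m%:R by rewrite subr_gt0 -natrX ltr_nat.
rewrite -(ler_pM2l c0); apply: le_trans h _; rewrite mulrA ler_wpM2r // .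
have {}mt : m%:R <= Q ^+ t.-1 by rewrite -natrX ler_nat.
have et : Q ^+ t = Q * Q ^+ t.-1 by rewrite -exprS prednK.
have ek : Q ^+ k' = Q ^+ (k' - t).+1 * Q ^+ t.-1 by rewrite -exprD; congr (_ ^+ _); nlia.
have g1 : 1 <= gnum (k' - t).+1.
  rewrite (le_trans _ (gnum_leS (ltn0Sn _))) // /gnum big_ord1 expr0 //.
have e := gnumE (k' - t).+1; have := expQ_gt0 t.-1.
rewrite et ek (_ : Q ^+ (k' - t).+1 = (Q - 1) * gnum (k' - t).+1 + 1); last by rewrite e subrK.
move: (gnum _) g1 => g g1 P0; nra.
Qed.

(** As long as the dimension is below [tau], some member of [H] witnesses that the current flat is
    no cover, and [sup_noncover_le] climbs one dimension at the price of one factor [k'-t+1]_q. *)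
Lemma chain_noncover G (H : {set {set V}}) k k' t tau : G \subset flats k -> H \subset flats k' ->
  (0 < t <= k')%N -> (tau <= k <= n)%N ->
  (forall A B, A \in G -> B \in H -> (q ^ t <= #|A :&: B|)%N) ->
  (forall s S, (s < tau)%N -> S \in flats s -> exists2 B, B \in H & (#|S :&: B| < q ^ t)%N) ->
  forall s S, (s <= tau)%N -> S \in flats s ->
  #|sup G S|%:R <= gnum (k' - t).+1 ^+ (tau - s) * nnum k tau.
Proof.
move=> Gk Hk tk tkn GH nc s S stau; move ed: (tau - s)%N => d.
elim: d s S stau ed => [|d IH] s S stau ed Ss.
  have es : s = tau by nlia.
  by rewrite expr0 mul1r -es; apply: (card_sup_le Gk) => //; nlia.
have [B BH SB] := nc s S ltac:(nlia) Ss.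
rewrite exprS -mulrA; apply: (sup_noncover_le Gk Ss (subsetP Hk _ BH)) => //.
- by move=> A AG; apply: GH.
- by rewrite mulr_ge0 ?exprn_ge0 ?gnum_ge0 // ltW // nnum_gt0.
- by move=> Y Ys _; apply: (IH s.+1) => //; nlia.
Qed.

(* [cnum t x] is the number of [t]-flats in a [(t + x)]-flat, see [chain_cover_eq]. *)
Definition hnum t x : R := \prod_(0 <= j < t) (Q ^+ (t + x) - Q ^+ j).
Definition cnum t x := Q ^+ x * (hnum t x / hnum t 0).

Lemma hnum_gt0 t x : 0 < hnum t x.
Proof.
rewrite /hnum big_seq_cond; apply: prodr_gt0 => j; rewrite mem_index_iota andbT => /andP[_ jt].
by rewrite subr_gt0 expQ_lt //; nlia.
Qed.

(** The recurrence of Gaussian binomials for t + x over t, cleared of denominators. *)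
Lemma hnumS t x : hnum t x.+1 * (Q ^+ x.+1 - 1) = hnum t x * (Q ^+ (t + x).+1 - 1).
Proof.
rewrite /hnum; case: t => [|t]; first by rewrite !big_geq.
rewrite big_nat_recl // expr0 big_nat_recr //= -mulrA [RHS]mulrC.
rewrite (_ : (t.+1 + x.+1 = (t.+1 + x).+1)%N); last by nlia.
congr (_ * _).
under eq_bigr => i _ do rewrite (exprS _ (t.+1 + x)) (exprS _ i) -mulrBr.
rewrite big_split /= prodr_const_nat subn0.
have -> : Q ^+ (t.+1 + x) - Q ^+ t = Q ^+ t * (Q ^+ x.+1 - 1).
  by rewrite mulrBr mulr1 -exprD addnS addSn.
by ring.
Qed.

Lemma cnum1 t : cnum t 1 = Q * gnum t.+1.
Proof.
rewrite /cnum expr1; congr (_ * _).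
have := hnumS t 0; rewrite addn0 => e.
have h0 := hnum_gt0 t 0; have := Q_ge2 => Q2.
apply: (@mulfI _ (Q - 1)); first by rewrite subr_eq0 gt_eqF //; lra.
apply: (@mulfI _ (hnum t 0)); first by rewrite gt_eqF.
by rewrite gnumE -e expr1; field; apply: lt0r_neq0.
Qed.

Lemma cnum_ge0 t x : 0 <= cnum t x.
Proof. by rewrite mulr_ge0 ?divr_ge0 // ltW // ?expQ_gt0 ?hnum_gt0. Qed.

(** By [hnumS], each unit of [x] multiplies [hnum] by at most q^(t+1); the prefactor q^x of [cnum]
    adds one more power. This crude bound is enough for [far_bound]. *)
Lemma cnum_le t x : cnum t x <= Q ^+ ((t + 2) * x).
Proof.
suff h : hnum t x <= Q ^+ ((t + 1) * x) * hnum t 0.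
  rewrite /cnum (_ : (t + 2) * x = x + (t + 1) * x)%N; last by nlia.
  by rewrite exprD ler_pM2l ?expQ_gt0 // ler_pdivrMr // hnum_gt0.
elim: x => [|x IH]; first by rewrite muln0 expr0 mul1r.
have Q2 := Q_ge2; have x0 := expQ_gt0 x; have Q1 := expQ_le (leq0n x); rewrite expr0 in Q1.
have c0 : 0 < Q ^+ x.+1 - 1 by rewrite exprS; nra.
rewrite -(ler_pM2r c0) hnumS mulnS exprD.
have h1 : Q ^+ (t + x).+1 - 1 <= Q ^+ (t + 1) * (Q ^+ x.+1 - 1).
  rewrite !exprS !exprD expr1; have Pt := expQ_gt0 t.
  have h2 : Q ^+ x <= Q * Q ^+ x - 1 by nra.
  have := ler_wpM2l (ltW (mulr_gt0 Pt Q_gt0)) h2; lra.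
have := hnum_gt0 t x; have := hnum_gt0 t 0; have := expQ_gt0 ((t + 1) * x).
move: IH h1 c0; set a := hnum t x; set b := hnum t 0; set c := Q ^+ (_ * x).
set d := Q ^+ (t + x).+1; set e := Q ^+ (t + 1); set f := Q ^+ x.+1.
move=> IH h1 c0 cp bp ap.
rewrite (_ : e * c * b * (f - 1) = (c * b) * (e * (f - 1))); last by ring.
apply: ler_pM => //; first exact: ltW.
by rewrite subr_ge0 -(expr0 Q) expQ_le.
Qed.

Lemma card_setD_flats S X s k : S \in flats s -> X \in flats k -> S \subset X ->
  #|X :\: S|%:R = Q ^+ k - Q ^+ s.
Proof.
move=> Ss Xk SX; rewrite cardsD (setIidPr SX) (card_flats Xk) (card_flats Ss).
by rewrite natrB ?natrX // leq_exp2l ?(q_gt1 F) // (flats_leq_sub Ss Xk).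
Qed.

(** Each member contains a t-flat of [X]. Building that t-flat point by point inside [X] produces
    the factor [cnum t x] without a separate count of the t-flats of [X]. *)
Lemma chain_cover G k X t x (B : R) : G \subset flats k -> X \in flats (t + x) ->
  (forall A, A \in G -> (q ^ t <= #|A :&: X|)%N) -> 0 <= B ->
  (forall H : {set V}, H \in flats t -> H \subset X -> #|sup G H|%:R <= B) ->
  #|G|%:R <= cnum t x * B.
Proof.
move=> Gk Xt hG B0 hB.
have inner s S : (s <= t)%N -> S \in flats s -> S \subset X -> #|sup G S|%:R <=
    (\prod_(s <= j < t) ((Q ^+ (t + x) - Q ^+ j) / (Q ^+ t - Q ^+ j))) * B.
  move=> st; move ed: (t - s)%N => d; elim: d s S st ed => [|d IH] s S st ed Ss SX.
    have es : s = t by nlia.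
    by rewrite es in Ss *; rewrite big_geq // mul1r hB.
  have st' : (s < t)%N by nlia.
  rewrite big_ltn // -mulrA -(ler_pM2l (_ : 0 < Q ^+ t - Q ^+ s)); last first.
    by rewrite subr_gt0 expQ_lt.
  rewrite [leRHS]mulrA [X in _ <= X * _]mulrC divfK; last by rewrite subr_eq0 gt_eqF // expQ_lt.
  rewrite -(card_setD_flats Ss Xt SX); apply: (sup_step_le Gk) => [A AG SA|y yX yS].
    rewrite card_capD // (setIidPl SX) (card_flats Ss).
    have qst : (q ^ s <= q ^ t)%N by rewrite leq_exp2l ?(q_gt1 F).
    rewrite natrB; last exact: leq_trans (hG _ AG).
    by rewrite natrX lerD2r -natrX ler_nat hG.
  apply: (IH s.+1); try nlia; first exact: join_flats.
  by rewrite join_sub ?yX // (flats_flat Xt).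
rewrite -(ler_pM2l (expQ_gt0 t)).
(* The empty set is not a flat, so the choice of the first point is a separate step; it contributes
   q^(t+x) / q^t, the prefactor q^x of [cnum]. *)
have := @sup_step_le G k set0 X (Q ^+ t) ((hnum t x / hnum t 0) * B) Gk.
rewrite setD0 (card_flats Xt) natrX.
have -> : sup G set0 = G by apply/setP=> A; rewrite inE sub0set andbT.
have -> : Q ^+ t * (cnum t x * B) = Q ^+ (t + x) * (hnum t x / hnum t 0 * B).
  by rewrite /cnum exprD; ring.
apply=> [A AG _|y yX _]; first by rewrite -natrX ler_nat hG.
have fy := set1_flats y; rewrite /hnum -prodf_div addn0.
rewrite /join setU0; apply: le_trans (inner _ _ _ fy _) => //; last by rewrite sub1set.
rewrite ler_nat; apply: subset_leq_card; apply/subsetP=> A; rewrite !inE.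
by move=> /andP[-> /(subset_trans (sub_aff_hull _))].
Qed.

Lemma chain_cover_eq G k X t x (B : R) : G \subset flats k -> X \in flats (t + x) ->
  (forall A, A \in G -> #|A :&: X| = (q ^ t)%N) ->
  (forall H : {set V}, H \in flats t -> H \subset X -> #|sup G H|%:R = B) ->
  #|G|%:R = cnum t x * B.
Proof.
move=> Gk Xt hG hB.
have inner s S : (s <= t)%N -> S \in flats s -> S \subset X -> #|sup G S|%:R =
    (\prod_(s <= j < t) ((Q ^+ (t + x) - Q ^+ j) / (Q ^+ t - Q ^+ j))) * B.
  move=> st; move ed: (t - s)%N => d; elim: d s S st ed => [|d IH] s S st ed Ss SX.
    have es : s = t by nlia.
    by rewrite es in Ss *; rewrite big_geq // mul1r hB.
  have st' : (s < t)%N by nlia.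
  have c0 : Q ^+ t - Q ^+ s != 0 by rewrite subr_eq0 gt_eqF // expQ_lt.
  rewrite big_ltn // -mulrA; apply: (mulfI c0).
  rewrite [RHS]mulrA [X in _ = X * _]mulrC divfK //.
  rewrite -(card_setD_flats Ss Xt SX); apply: (sup_step_eq Gk) => [A AG SA|y yX yS].
    rewrite card_capD // (setIidPl SX) (card_flats Ss) (hG _ AG).
    by rewrite natrB ?natrX // leq_exp2l ?(q_gt1 F).
  apply: (IH s.+1); try nlia; first exact: join_flats.
  by rewrite join_sub ?yX // (flats_flat Xt).
apply: (mulfI (lt0r_neq0 (expQ_gt0 t))).
have := @sup_step_eq G k set0 X (Q ^+ t) ((hnum t x / hnum t 0) * B) Gk.
rewrite setD0 (card_flats Xt) natrX.
have -> : sup G set0 = G by apply/setP=> A; rewrite inE sub0set andbT.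
have -> : Q ^+ t * (cnum t x * B) = Q ^+ (t + x) * (hnum t x / hnum t 0 * B).
  by rewrite /cnum exprD; ring.
apply=> [A AG _|y yX _]; first by rewrite hG // natrX.
have fy := set1_flats y; rewrite /hnum -prodf_div addn0.
rewrite /join setU0 -(inner _ _ _ fy) ?sub1set //; congr (_%:R); apply: eq_card => A.
rewrite !inE; have [AG|//] := boolP (A \in G); apply/idP/idP => /=.
  exact/subset_trans/sub_aff_hull.
by apply: aff_hull_min; apply: flats_flat (subsetP Gk _ AG).
Qed.

End Counting.

(** * Sizes of the four model families *)

Section Families.
Context {R : realFieldType}.
Variables (F : finFieldType) (n : nat).
Local Notation V := 'rV[F]_n.
Local Notation q := #|F|.
Local Notation Q := (#|F|%:R%R : R).
Local Notation gnum := (@gnum R F).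
Local Notation nnum := (@nnum R F n).
Local Notation wnum := (@wnum R F n).
Implicit Types (A B M S T X : {set V}) (G : {set {set V}}).
Local Open Scope ring_scope.

(** A form of [nnum_decr] that survives s = k, where no k-flat contains [Y]. *)
Lemma sup_le_div k s Y G : G \subset flats k -> (s <= k <= n)%N -> Y \in flats s.+1 ->
  #|sup G Y|%:R <= nnum k s / Q ^+ (n - k).
Proof.
move=> Gk /andP[sk kn] Rs; rewrite ler_pdivlMr ?expQ_gt0 //.
move: sk; rewrite leq_eqVlt => /orP[/eqP sk|sk]; last first.
  have skn : (s < k <= n)%N by rewrite sk.
  rewrite mulrC; apply: le_trans (nnum_decr F skn).
  by rewrite ler_pM2l ?expQ_gt0 // (card_sup_le Gk).
have -> : sup G Y = set0.
  apply/setP=> A; rewrite in_sup inE; apply/negP => /andP[/(subsetP Gk) Ak RA].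
  by have := flats_leq_sub Rs Ak RA; rewrite sk ltnn.
by rewrite cards0 mul0r; apply: ltW; apply: nnum_gt0; rewrite sk leqnn.
Qed.

(** Of all k-flats through [Y], those meeting [M] in more than [Y] are few: as [Y] is too small to
    meet [M] in dimension r + 1, [sup_noncover_le] bounds them by [m-r]_q N(k,r) / q^(n-k). *)
Lemma meet_flats_ge k r m Y M : (r < m)%N -> (r <= k <= n)%N ->
  Y \in flats r -> M \in flats m -> Y \subset M ->
  (Q ^+ (n - k) - gnum (m - r)) * nnum k r <= Q ^+ (n - k) * #|meet_flats k Y M|%:R.
Proof.
move=> rm rkn Rr Mm RM.
pose G := [set A in flats k | (q ^ r.+1 <= #|A :&: M|)%N].
have Gk : G \subset flats k by apply/subsetP => A; rewrite inE => /andP[].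
have rest : #|sup G Y|%:R <= gnum (m - r) * (nnum k r / Q ^+ (n - k)).
  rewrite (_ : (m - r = (m - r.+1).+1)%N); last by nlia.
  apply: (sup_noncover_le Gk Rr Mm) => //.
  - by move=> A; rewrite inE => /andP[].
  - by rewrite (setIidPl RM) (card_flats Rr) ltn_exp2l ?(q_gt1 F).
  - by rewrite divr_ge0 // ltW // ?expQ_gt0 // nnum_gt0.
  - by move=> A Ar _; apply: (sup_le_div Gk).
have : (#|sup (flats k) Y| <= #|meet_flats k Y M| + #|sup G Y|)%N.
  apply: leq_trans (leq_card_setU _ _); apply: subset_leq_card.
  apply/subsetP=> A; rewrite in_sup in_setU in_meet in_sup => /andP[Ak RA].
  rewrite Ak RA andbT /=.
  have [x xR] := flats_point Rr.
  have /flatP[c Ic] := flatI (flats_flat Ak) (flats_flat Mm) (subsetP RA _ xR) (subsetP RM _ xR).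
  have RI : Y \subset A :&: M by rewrite subsetI RA.
  have := flats_leq_sub Rr Ic RI; rewrite leq_eqVlt => /orP[/eqP rc|rc].
    by rewrite -rc in Ic; rewrite (flats_sub_eq Rr Ic RI) eqxx.
  by rewrite inE Ak (card_flats Ic) leq_exp2l ?(q_gt1 F) // rc orbT.
rewrite -(ler_nat R) natrD (card_sup_flats rkn Rr).
have e : Q ^+ (n - k) * (gnum (m - r) * (nnum k r / Q ^+ (n - k))) = gnum (m - r) * nnum k r.
  by field; rewrite gt_eqF // expQ_gt0.
move=> h; rewrite mulrBl -e -mulrBr ler_pM2l ?expQ_gt0 //; lra.
Qed.

Lemma in_famA1 M T k t A : flat M -> (A \in famA1 M T k t) =
  [&& A \in flats k, T \subset A & (q ^ t.+1 <= #|A :&: M|)%N].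
Proof.
move=> fM; rewrite in_set; have [Ak|//] := boolP (A \in flats k).
by rewrite flat_capP //; exact: (flats_flat Ak).
Qed.

Lemma mem_famA2 M T k t A : (A \in famA2 M T k t) = (A \in flats k) &&
  ((T \subset A) || (A \subset M) && (flat_dim (A :&: T) == t%:Z - 1)).
Proof.
rewrite in_setU; apply/orP/andP => [[]|[Ak /orP[TA|/andP[AM AT]]]].
- by rewrite in_set => /andP[-> ->].
- by rewrite in_set => /andP[]; rewrite in_set => /andP[-> ->] ->; rewrite orbT.
- by left; rewrite in_set Ak.
- by right; rewrite in_set AT andbT in_set Ak.
Qed.

Lemma in_famA2 M T k t A : flat T -> (0 < t)%N -> (A \in famA2 M T k t) =
  (A \in flats k) && ((T \subset A) || (A \subset M) && (#|A :&: T| == q ^ t.-1)%N).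
Proof.
move=> fT t0; rewrite mem_famA2; have [Ak|//] := boolP (A \in flats k).
rewrite (_ : t%:Z - 1 = t.-1%:Z); last by nlia.
by rewrite flat_cap_eqP //; exact: (flats_flat Ak).
Qed.

Lemma in_famA3 S k A : (A \in famA3 S k) = (A \in flats k) && (S \subset A).
Proof. by rewrite in_set. Qed.

Lemma in_famA4 S k t A : flat S -> (A \in famA4 S k t) =
  (A \in flats k) && (q ^ t <= #|A :&: S|)%N.
Proof.
move=> fS; rewrite in_set; have [Ak|//] := boolP (A \in flats k).
by rewrite flat_capP //; exact: (flats_flat Ak).
Qed.

Lemma sub_famA1 M T k t : famA1 M T k t \subset flats k.
Proof. by apply/subsetP=> A; rewrite in_set => /andP[]. Qed.

Lemma sub_famA2 M T k t : famA2 M T k t \subset flats k.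
Proof.
by apply/subsetP=> A; rewrite mem_famA2 => /andP[].
Qed.

Lemma sub_famA3 S k : famA3 S k \subset flats k.
Proof. by apply/subsetP=> A; rewrite in_set => /andP[]. Qed.

Lemma sub_famA4 S k t : famA4 S k t \subset flats k.
Proof. by apply/subsetP=> A; rewrite in_set => /andP[]. Qed.

Lemma flat_cap_small A T t : flat A -> T \in flats t -> ~~ (T \subset A) -> (0 < t)%N ->
  (#|A :&: T| <= q ^ t.-1)%N.
Proof.
move=> fA Tt TA t0; have [->|[x]] := set_0Vmem (A :&: T); first by rewrite cards0.
rewrite inE => /andP[xA xT].
have /flatP[c Ic] := flatI fA (flats_flat Tt) xA xT.
have ct := flats_leq_sub Ic Tt (subsetIr _ _).
have ct' : c != t.
  apply: contraNneq TA => ct'; rewrite ct' in Ic.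
  by rewrite -(flats_sub_eq Ic Tt (subsetIr _ _)) subsetIl.
rewrite (card_flats Ic) leq_exp2l ?(q_gt1 F) //; nlia.
Qed.

(** Each member contains one of the q [t+1]_q t-flats [H] of [S]. It also has at least q^t - q^(t-1)
    points in [S' :\: T], which misses [H] because [S :&: S' = T]. Since [S' :\: T] has q (q^t -
    q^(t-1)) points, at most q N(k,t+1) members pass through [H]. *)
Lemma two_covers_le G k t T S S' : (0 < t < k)%N -> (k <= n)%N -> G \subset flats k ->
  T \in flats t -> S \in flats t.+1 -> S' \in flats t.+1 -> T \subset S -> T \subset S' ->
  S != S' -> (forall A, A \in G -> [/\ ~~ (T \subset A), (q ^ t <= #|A :&: S|)%N &
    (q ^ t <= #|A :&: S'|)%N]) ->
  #|G|%:R <= Q ^+ 2 * gnum t.+1 * nnum k t.+1.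
Proof.
move=> /andP[t0 tk] kn Gk Tt St St' TS TS' SS' hG.
have N0 : 0 < nnum k t.+1 by apply: nnum_gt0; nlia.
have eT : S :&: S' = T.
  have [x xT] := flats_point Tt.
  have /flatP[c Ic] := flatI (flats_flat St) (flats_flat St') (subsetP TS _ xT) (subsetP TS' _ xT).
  have TI : T \subset S :&: S' by rewrite subsetI TS.
  have := flats_leq_sub Ic St (subsetIl _ _); have := flats_leq_sub Tt Ic TI.
  rewrite leq_eqVlt => /orP[/eqP tc _|tc ct].
    by rewrite -tc in Ic; rewrite (flats_sub_eq Tt Ic TI).
  have ec : c = t.+1 by nlia.
  rewrite ec in Ic; case/eqP: SS'; rewrite -(flats_sub_eq Ic St (subsetIl _ _)).
  by rewrite -{2}(flats_sub_eq Ic St' (subsetIr _ _)).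
rewrite (_ : Q ^+ 2 * _ * _ = cnum F t 1 * (Q * nnum k t.+1)); last by rewrite cnum1; ring.
rewrite -(addn1 t) in St; apply: (chain_cover Gk St).
- by move=> A /hG[].
- by rewrite mulr_ge0 ?ltW ?Q_gt0.
move=> H Ht HS.
have HS'T : [disjoint H & S' :\: T].
  apply/pred0P => x /=; apply/negP => /andP[xH].
  by rewrite inE => /andP[/negP xT xS']; case: xT; rewrite -eT inE xS' (subsetP HS).
have Qt : 0 < Q ^+ t - Q ^+ t.-1 by rewrite subr_gt0 expQ_lt // ltn_predL.
have cD : (S' :\: T) :\: H = S' :\: T by apply/setDidPl; rewrite disjoint_sym.
have h : (Q ^+ t - Q ^+ t.-1) * #|sup G H|%:R <= #|(S' :\: T) :\: H|%:R * nnum k t.+1.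
  apply: (sup_step_le Gk) => [A AG HA|y _ yH]; last first.
    by apply: (card_sup_le Gk) (join_flats Ht yH); nlia.
  have [TA _ AS'] := hG A AG; have fA := flats_flat (subsetP Gk _ AG).
  have h1 := flat_cap_small fA Tt TA t0.
  have h2 : A :&: T \subset A :&: S' by apply: setIS.
  have h3 : (A :&: S') :\: (A :&: T) \subset A :&: ((S' :\: T) :\: H).
    rewrite cD; apply/subsetP=> x; rewrite !inE => /andP[+ /andP[xA xS']].
    by rewrite xA xS' andbT.
  apply: (@le_trans _ _ #|(A :&: S') :\: (A :&: T)|%:R); last first.
    by rewrite ler_nat subset_leq_card.
  rewrite cardsD (setIidPr h2) natrB ?subset_leq_card //.
  by apply: lerB; rewrite -natrX ler_nat.
rewrite cD (card_setD_flats Tt St' TS') in h.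
rewrite -(ler_pM2l Qt); apply: (le_trans h).
have et : Q ^+ t = Q * Q ^+ t.-1 by rewrite -exprS prednK.
have -> : Q ^+ t.+1 - Q ^+ t = (Q ^+ t - Q ^+ t.-1) * Q by rewrite exprS et; ring.
by rewrite -mulrA.
Qed.

Lemma flats_sub_pair t l T M : T \in flats t -> M \in flats l.+1 -> (t < l)%N -> T \subset M ->
  exists S S', [/\ S \in flats t.+1, S' \in flats t.+1, T \subset S :&: S',
    S :|: S' \subset M & S != S'].
Proof.
move=> Tt Ml tl TM; have fM := flats_flat Ml.
have [y yM yT] := flats_proper_point Tt Ml (ltnW tl : (t < l.+1)%N).
have jy := join_flats Tt yT.
have [z zM zj] := flats_proper_point jy Ml (tl : (t.+1 < l.+1)%N).
have zT : z \notin T by apply: contra zj; apply/subsetP/sub_join.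
exists (join T y), (join T z); split; rewrite ?join_flats //.
- by rewrite subsetI !sub_join.
- by rewrite subUset !join_sub // yM zM TM.
- by apply: contraNneq zj => ->; apply: join_mem.
Qed.

Lemma card_famA3 k t S : (t < k <= n)%N -> S \in flats t.+1 ->
  #|famA3 S k|%:R = nnum k t.+1.
Proof. by move=> tkn St; rewrite -(card_sup_flats (_ : (t.+1 <= k <= n)%N) St). Qed.

(** A member contains [S] or meets it in exactly one of its q [t+1]_q t-flats. For each such t-flat,
    the flats through it minus those through [S] are counted. *)
Lemma card_famA4 l t S : (t < l <= n)%N -> S \in flats t.+1 ->
  #|famA4 S l t|%:R = Q * gnum t.+1 * (nnum l t - nnum l t.+1) + nnum l t.+1.
Proof.
move=> /andP[tl ln] St; have fS := flats_flat St.
pose G := [set A in famA4 S l t | #|A :&: S| == (q ^ t)%N].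
have inG A : (A \in G) = (A \in flats l) && (#|A :&: S| == (q ^ t)%N).
  rewrite inE in_famA4 //; case: (A \in _) => //=.
  by case: eqVneq => [->|_]; rewrite ?leqnn ?andbF.
have Gl : G \subset flats l by apply/subsetP=> A; rewrite inG => /andP[].
have dich A : A \in flats l -> (q ^ t <= #|A :&: S|)%N = (#|A :&: S| == (q ^ t)%N) || (S \subset A).
  move=> Al; have [SA|SA] := boolP (S \subset A).
    by rewrite (setIidPr SA) (card_flats St) leq_exp2l ?(q_gt1 F) // leqnSn orbT.
  have := flat_cap_small (flats_flat Al) St SA isT => /= h.
  by rewrite orbF eqn_leq h.
have cG : #|G|%:R = Q * gnum t.+1 * (nnum l t - nnum l t.+1).
  rewrite -cnum1; have St1 := St; rewrite -(addn1 t) in St1.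
  apply: (chain_cover_eq Gl St1) => [A|H Ht HS]; first by rewrite inG => /andP[_ /eqP].
  rewrite -(card_sup_flats (_ : (t <= l <= n)%N) Ht) -?(card_sup_flats (_ : (t.+1 <= l <= n)%N) St); try nlia.
  have sub : sup (flats l) S \subset sup (flats l) H.
    by apply/subsetP=> A; rewrite !in_sup => /andP[-> /(subset_trans HS)].
  rewrite -natrB ?subset_leq_card //; congr (_%:R).
  rewrite -(cardsID (sup (flats l) S) (sup (flats l) H)) (setIidPr sub) addKn.
  apply: eq_card => A; rewrite in_setD !in_sup inG.
  have [Al|] := boolP (A \in flats l); rewrite /= ?andbF //.
  have [HA|] := boolP (H \subset A); rewrite /= ?andbF // !andbT.
  have : (q ^ t <= #|A :&: S|)%N.
    by rewrite -(card_flats Ht) subset_leq_card // subsetI HA.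
  rewrite dich //; have [SA|_] := boolP (S \subset A); last by rewrite orbF => ->.
  rewrite (setIidPr SA) (card_flats St) => _.
  by rewrite (inj_eq (expnI (q_gt1 F))); nlia.
rewrite -cG -(card_sup_flats (_ : (t.+1 <= l <= n)%N) St) -?natrD; last by nlia.
congr (_%:R); rewrite -(cardsID G (famA4 S l t)); congr (_ + _)%N; apply: eq_card => A.
  rewrite in_setI in_famA4 // inG; have [Al|//] := boolP (A \in flats l).
  by rewrite /= dich //; apply: andb_idl => ->.
rewrite in_setD in_famA4 // inG in_sup; have [Al|] := boolP (A \in flats l); rewrite /= ?andbF //.
rewrite dich //; have [SA|_] := boolP (S \subset A); last by rewrite orbF andNb.
by rewrite orbT andbT (setIidPr SA) (card_flats St) (inj_eq (expnI (q_gt1 F))); nlia.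
Qed.

Section Sizes.
Variables (k l t : nat) (M T : {set V}).
Hypotheses (t0 : (0 < t)%N) (tk : (t < k)%N) (tl : (t < l)%N) (hn : (k + l + t + 7 <= n)%N).
Hypotheses (Ml : M \in flats l.+1) (Tt : T \in flats t) (TM : T \subset M).

Let fM := flats_flat Ml.
Let fT := flats_flat Tt.

Lemma card_famA1_le : #|famA1 M T k t|%:R <= gnum (l - t).+1 * nnum k t.+1.
Proof.
have Gk := sub_famA1 M T k t.
have -> : famA1 M T k t = sup (famA1 M T k t) T.
  apply/setP=> A; rewrite in_sup in_famA1 //; case: (A \in _); case: (T \subset A) => //=.
  by rewrite andbT.
rewrite (_ : (l - t = l.+1 - t.+1)%N); last by nlia.
apply: (sup_noncover_le Gk Tt Ml).
- by nlia.
- by move=> A; rewrite in_famA1 // => /and3P[].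
- by rewrite (setIidPl TM) (card_flats Tt) ltn_exp2l ?(q_gt1 F).
- by apply/ltW/nnum_gt0; nlia.
- by move=> Y Rt _; apply: (card_sup_le Gk _ Rt); nlia.
Qed.

(** The complement among the k-flats through [T] consists of those meeting [M] in [T] only.
    [fam12_swap_lt] needs this exact value, since bounds would blur its small gain. *)
Lemma card_famA1E : #|famA1 M T k t|%:R = nnum k t - wnum k t l.+1.
Proof.
rewrite -(card_sup_flats (_ : (t <= k <= n)%N) Tt); last by nlia.
rewrite -(card_meet_flats (_ : (t <= k)%N) _ Tt Ml TM); try nlia.
rewrite -natrB; last first.
  apply: subset_leq_card; apply/subsetP=> A; rewrite in_meet in_sup => /andP[-> /eqP <-].
  exact: subsetIl.
congr (_%:R); rewrite -[X in (X - _)%N](cardsID (meet_flats k T M)).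
have -> : sup (flats k) T :&: meet_flats k T M = meet_flats k T M.
  apply/setIidPr/subsetP=> A; rewrite in_meet in_sup => /andP[-> /eqP <-].
  exact: subsetIl.
rewrite addKn; apply: eq_card => A; rewrite in_famA1 // in_setD in_meet in_sup.
have [Ak|_] := boolP (A \in flats k); rewrite /= ?andbF //.
have [TA|_] := boolP (T \subset A); rewrite /= ?andbF // andbT.
have TI : T \subset A :&: M by rewrite subsetI TA.
have [x xT] := flats_point Tt.
have /flatP[c Ic] := flatI (flats_flat Ak) fM (subsetP TA _ xT) (subsetP TM _ xT).
have tc := flats_leq_sub Tt Ic TI.
rewrite (card_flats Ic) leq_exp2l ?(q_gt1 F) // ltn_neqAle tc andbT; congr (~~ _).
apply/eqP/eqP => [e|e]; first by rewrite -e in Ic; rewrite (flats_sub_eq Tt Ic TI).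
by rewrite e in Ic; apply: flats_dim_inj Tt Ic.
Qed.

(** Only members meeting [M] in exactly a (t+1)-flat are counted: there are [l-t+1]_q such flats
    through [T], and [meet_flats_ge] treats each. *)
Lemma card_famA1_ge :
  gnum (l - t).+1 * ((Q ^+ (n - k) - gnum (l - t)) * nnum k t.+1)
    <= Q ^+ (n - k) * #|famA1 M T k t|%:R.
Proof.
pose G := [set A in famA1 M T k t | #|A :&: M| == (q ^ t.+1)%N].
have GA : G \subset famA1 M T k t by apply/subsetP=> A; rewrite inE => /andP[].
have Gk := subset_trans GA (sub_famA1 M T k t).
have inG A : (A \in G) = [&& A \in flats k, T \subset A & #|A :&: M| == (q ^ t.+1)%N].
  rewrite inE in_famA1 //; case: (A \in _); case: (T \subset A) => //=.
  by case: eqVneq => [->|_]; rewrite ?leqnn ?andbF.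
have eG : G = sup G T.
  by apply/setP=> A; rewrite in_sup inG; case: (T \subset A); rewrite ?andbF ?andbT.
have tkn : (t.+1 + (k - t.+1) <= n)%N by nlia.
have h : (Q ^+ t.+1 - Q ^+ t) * #|G|%:R = (Q ^+ l.+1 - Q ^+ t) * wnum k t.+1 l.+1.
  rewrite {1}eG -(card_setD_flats Tt Ml TM); apply: (sup_step_eq Gk).
    move=> A; rewrite inG => /and3P[_ TA /eqP AM] _.
    rewrite card_capD // AM (setIidPl TM) (card_flats Tt) natrB ?natrX //.
    by rewrite leq_exp2l ?(q_gt1 F).
  move=> y yM yT; have jt := join_flats Tt yT.
  have jM : join T y \subset M by rewrite join_sub // yM.
  rewrite -(card_meet_flats _ _ jt Ml jM); try nlia.
  congr (_%:R); apply: eq_card => A; rewrite in_sup in_meet inG.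
  have [Ak|//] := boolP (A \in flats k); rewrite /=.
  apply/idP/eqP => [/andP[/andP[TA /eqP AM] jA]|AM].
    apply/esym/eqP; rewrite eqEcard subsetI jA jM AM (card_flats jt) leqnn //.
  have jA : join T y \subset A by rewrite -AM subsetIl.
  by rewrite jA (subset_trans (sub_join _ _) jA) AM (card_flats jt) eqxx.
have ttl : (t <= t.+1 <= l.+1)%N by nlia.
have [Y [Rt TR RM]] := flats_between Tt Ml TM ttl.
have tkn' : (t.+1 <= k <= n)%N by nlia.
have h2 := meet_flats_ge (tl : (t.+1 < l.+1)%N) tkn' Rt Ml RM.
rewrite (card_meet_flats _ _ Rt Ml RM) ?subSS in h2; try nlia.
have g0 := gnum_ge0 (R := R) F (l - t).+1.
apply: le_trans (ler_wpM2l g0 h2) _; rewrite mulrCA ler_pM2l ?expQ_gt0 //.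
apply: (@le_trans _ _ #|G|%:R); last by rewrite ler_nat subset_leq_card.
have Qt : 0 < Q ^+ t.+1 - Q ^+ t by rewrite subr_gt0 expQ_lt.
rewrite -(ler_pM2l Qt) h mulrA.
suff -> : (Q ^+ t.+1 - Q ^+ t) * gnum (l - t).+1 = Q ^+ l.+1 - Q ^+ t by [].
rewrite exprS -{2}[Q ^+ t]mul1r -mulrBl mulrAC gnumE mulrBl mul1r -exprD.
by congr (_ ^+ _ - _); nlia.
Qed.

Lemma card_famA2_ge : nnum l t <= #|famA2 M T l t|%:R.
Proof.
rewrite -(card_sup_flats (_ : (t <= l <= n)%N) Tt); last by nlia.
rewrite ler_nat; apply: subset_leq_card; apply/subsetP=> A.
by rewrite in_sup in_famA2 // => /andP[-> ->].
Qed.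

(** A member not through [T] is a hyperplane of [M] meeting [T], so by [hyperplane_cap] it meets
    every (t+1)-flat of [M] through [T] in dimension at least t. Two such flats suffice for
    [two_covers_le]. *)
Lemma card_famA2_le :
  #|famA2 M T l t|%:R <= nnum l t + Q ^+ 2 * gnum t.+1 * nnum l t.+1.
Proof.
have [S1 [S2 [S1t S2t]]] := flats_sub_pair Tt Ml tl TM.
rewrite subsetI subUset => /andP[TS1 TS2] /andP[S1M S2M] S12.
rewrite -(card_sup_flats (_ : (t <= l <= n)%N) Tt); last by nlia.
have /(_ (famA2 M T l t :\: sup (flats l) T)) := two_covers_le (_ : (0 < t < l)%N) _ _ Tt S1t S2t TS1 TS2 S12.
move=> h; have -> : famA2 M T l t = sup (flats l) T :|: (famA2 M T l t :\: sup (flats l) T).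
  apply/setP=> A; rewrite in_famA2 // in_setU in_setD in_famA2 // in_sup.
  by case: (A \in _) => //=; case: (T \subset A).
apply: (@le_trans _ _ (#|sup (flats l) T| + #|famA2 M T l t :\: sup (flats l) T|)%:R).
  by rewrite ler_nat leq_card_setU.
rewrite natrD lerD2l; apply: h; try nlia.
  by apply: subset_trans (sub_famA2 M T l t); apply: subsetDl.
move=> A; rewrite in_setD in_famA2 // in_sup.
have [Al|] := boolP (A \in flats l); rewrite /= ?andbF //.
have [TA|TA] := boolP (T \subset A) => //= /andP[AM /eqP AT].
have cap Y : Y \in flats t.+1 -> T \subset Y -> Y \subset M -> (q ^ t <= #|A :&: Y|)%N.
  move=> Rt TR RM; have := hyperplane_cap Al Ml AM (flats_flat Rt) RM.
  rewrite (card_flats Rt) expnS leq_pmul2l ?(q_gt0 F) // setIC; apply.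
  rewrite setIC -card_gt0; apply: leq_trans (subset_leq_card (setIS _ TR)).
  by rewrite AT expq_gt0.
by split; rewrite ?cap.
Qed.

End Sizes.

End Families.

(** * Numerical comparisons under the lower bound on n *)

Section Comparisons.
Context {R : realFieldType}.
Variables (F : finFieldType) (n : nat).
Local Notation V := 'rV[F]_n.
Local Notation q := #|F|.
Local Notation Q := (#|F|%:R%R : R).
Local Notation gnum := (@gnum R F).
Local Notation nnum := (@nnum R F n).
Local Notation wnum := (@wnum R F n).
Implicit Types (M S T : {set V}).
Local Open Scope ring_scope.

Lemma expQ_ge m c : (0 < m)%N -> (c <= 2 ^ m)%N -> c%:R <= Q ^+ m.
Proof.
move=> m0 cm; rewrite -natrX ler_nat (leq_trans cm) //.
by rewrite leq_exp2r // (q_gt1 F).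
Qed.

Lemma gnum_mulQ m : Q * gnum m = gnum m.+1 - 1.
Proof. by have := gnumE (R := R) F m; rewrite gnumS; lra. Qed.

Lemma gnum_ge1 m : (0 < m)%N -> 1 <= gnum m.
Proof. by move=> m0; apply: le_trans (gnum_leS F m0); rewrite /gnum big_ord1. Qed.

(** Once the last factor is restored, both numerators are the product of q^n - q^j over t <= j <= k
    + l - t: the left one lacks j = l, the right one j = k. *)
Lemma wnum_swap k l t : (t <= k)%N -> (t <= l)%N ->
  wnum k t l.+1 * nnum l t * (Q ^+ n - Q ^+ l) = wnum l t k.+1 * nnum k t * (Q ^+ n - Q ^+ k).
Proof.
move=> tk tl; rewrite /nnum /wnum.
pose f j := Q ^+ n - Q ^+ j; pose K := (k + l - t).+1.
have e1 : \prod_(t <= j < t + (l - t)) f j * f l * \prod_(l.+1 <= j < l.+1 + (k - t)) f j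
    = \prod_(t <= j < K) f j.
  rewrite subnKC // -big_nat_recr //= (_ : (l.+1 + (k - t) = K)%N); last by rewrite /K; nlia.
  by rewrite -big_cat_nat //= /K; nlia.
have e2 : \prod_(t <= j < t + (k - t)) f j * f k * \prod_(k.+1 <= j < k.+1 + (l - t)) f j
    = \prod_(t <= j < K) f j.
  rewrite subnKC // -big_nat_recr //= (_ : (k.+1 + (l - t) = K)%N); last by rewrite /K; nlia.
  by rewrite -big_cat_nat //= /K; nlia.
transitivity ((\prod_(t <= j < K) f j) /
    ((\prod_(t <= j < k) (Q ^+ k - Q ^+ j)) * (\prod_(t <= j < l) (Q ^+ l - Q ^+ j)))).
  by rewrite -e1 invfM /f; ring.
by rewrite -e2 invfM /f; ring.
Qed.

Section Numerics.
Variables (k l t : nat).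
Hypotheses (t0 : (0 < t)%N) (tk : (t < k)%N) (tl : (t < l)%N) (hn : (k + l + t + 7 <= n)%N).

Local Notation u := (gnum (l - t).+1).
Local Notation v := (gnum (k - t).+1).
Local Notation g := (gnum t.+1).
Local Notation gb := (gnum (l - t)).
Local Notation p := (Q ^+ (l - t)).
Local Notation Q1 := (Q ^+ (n - k)).
Local Notation Q2 := (Q ^+ (n - l)).
Local Notation N1 := (nnum k t).
Local Notation N1' := (nnum k t.+1).
Local Notation N2 := (nnum l t).
Local Notation N2' := (nnum l t.+1).

Lemma tkn : (t < k <= n)%N. Proof. by nlia. Qed.
Lemma tln : (t < l <= n)%N. Proof. by nlia. Qed.
Lemma base_ge2 : 2 <= Q. Proof. exact: Q_ge2. Qed.
Lemma gb_lt : gb < p. Proof. exact: gnum_lt. Qed.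
Lemma gb_ge1 : 1 <= gb. Proof. by apply: gnum_ge1; nlia. Qed.
Lemma p_le_mul_gb : p <= Q * gb. Proof. by rewrite gnum_mulQ gnumS; have := gb_ge1; lra. Qed.
Lemma u_split : u = gb + p. Proof. exact: gnumS. Qed.
Lemma p_gt0 : 0 < p. Proof. exact: expQ_gt0. Qed.
Lemma p_ge2 : 2 <= p.
Proof. by have := @expQ_le R F 1 (l - t); rewrite expr1 => h; apply: le_trans base_ge2 (h _); nlia. Qed.
Lemma p_le_mul : 2 * p <= Q * p. Proof. by rewrite ler_pM2r ?p_gt0 ?Q_ge2. Qed.
Lemma Q1_gt0 : 0 < Q1. Proof. exact: expQ_gt0. Qed.
Lemma Q2_gt0 : 0 < Q2. Proof. exact: expQ_gt0. Qed.
Lemma N1_gt0 : 0 < N1. Proof. by apply: nnum_gt0; nlia. Qed.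
Lemma N1'_gt0 : 0 < N1'. Proof. by apply: nnum_gt0; nlia. Qed.
Lemma N2_gt0 : 0 < N2. Proof. by apply: nnum_gt0; nlia. Qed.
Lemma N2'_gt0 : 0 < N2'. Proof. by apply: nnum_gt0; nlia. Qed.
Lemma N2'_le : Q2 * N2' <= N2. Proof. by apply: nnum_decr; nlia. Qed.
Lemma N1'_le : Q1 * N1' <= N1. Proof. by apply: nnum_decr; nlia. Qed.
Lemma g_ge1 : 1 <= g. Proof. exact: gnum_ge1. Qed.

Lemma g_gt0 : 0 < g. Proof. exact: lt_le_trans ltr01 g_ge1. Qed.
Lemma base_gt0 : 0 < Q. Proof. exact: Q_gt0. Qed.

#[local] Hint Resolve base_ge2 base_gt0 g_gt0 g_ge1 gb_ge1 p_gt0 Q1_gt0 Q2_gt0 N1_gt0 N1'_gt0 N2_gt0 N2'_gt0 : core.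

Lemma Q1_ge : 16 * Q * p <= Q1.
Proof.
have h : 16 <= Q ^+ 4 by exact: (@expQ_ge 4 16).
apply: (@le_trans _ _ (Q ^+ (4 + 1 + (l - t)))); last by apply: expQ_le; nlia.
rewrite (exprD Q (4 + 1)) (exprD Q 4 1) expr1.
by do 2?[rewrite ler_pM2r; last by [exact: p_gt0 | exact: Q_gt0]]; exact: h.
Qed.

Lemma Q2_ge (c : nat) m : (0 < m)%N -> (c <= 2 ^ m)%N -> (m <= k + t + 7)%N ->
  c%:R * Q ^+ (k + t + 7 - m) <= Q2.
Proof.
move=> m0 cm mk; apply: (@le_trans _ _ (Q ^+ (m + (k + t + 7 - m)))); last by apply: expQ_le; nlia.
by rewrite exprD ler_pM2r ?expQ_gt0 // expQ_ge.
Qed.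

Lemma Q2_ge_two_covers : 32 * Q * (Q ^+ 2 * g) <= Q2.
Proof.
apply: le_trans (@Q2_ge 32 5 _ _ _) => //; last by nlia.
apply: (@le_trans _ _ (32 * Q ^+ (1 + (2 + t.+1)))); last first.
  by rewrite ler_pM2l //; apply: expQ_le; nlia.
rewrite -mulrA ler_pM2l // !exprD expr1 !ler_pM2l ?Q_gt0 ?exprn_gt0 ?Q_gt0 //.
exact/ltW/gnum_lt.
Qed.

Lemma Q2_ge_one_cover : 32 * (Q * g * v) <= Q2.
Proof.
apply: le_trans (@Q2_ge 32 5 _ _ _) => //; last by nlia.
apply: (@le_trans _ _ (32 * Q ^+ (1 + t.+1 + (k - t).+1))); last first.
  by rewrite ler_pM2l //; apply: expQ_le; nlia.
rewrite ler_pM2l // !exprD expr1 -!mulrA ler_pM2l ?Q_gt0 //.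
by apply: ler_pM; rewrite ?gnum_ge0 // ltW // gnum_lt.
Qed.

Lemma Q2_gt_swap : 2 * v * Q ^+ 3 * g < Q2.
Proof.
apply: lt_le_trans (@Q2_ge 2 1 _ _ _) => //; last by nlia.
apply: (@lt_le_trans _ _ (2 * Q ^+ ((k - t).+1 + 3 + t.+1))); last first.
  by rewrite ler_pM2l //; apply: expQ_le; nlia.
rewrite (_ : 2 * v * Q ^+ 3 * g = 2 * (v * (Q ^+ 3 * g))); last by ring.
rewrite ltr_pM2l // exprD (exprD Q (k - t).+1) -[X in _ < X]mulrA; apply: ltr_pM.
- exact: gnum_ge0.
- by rewrite mulr_ge0 ?gnum_ge0 ?exprn_ge0 ?ler0n.
- exact: gnum_lt.
- by rewrite ltr_pM2l ?expQ_gt0 // gnum_lt.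
Qed.

Lemma Q1_ge_square : 8 * (u * u) <= p * Q1.
Proof.
have h : 32 * p <= Q1 by apply: le_trans Q1_ge; have := p_le_mul; lra.
have h1 : u * u <= (2 * p) * (2 * p).
  by apply: ler_pM; rewrite ?gnum_ge0 // u_split; have := gb_lt; lra.
have : p * (32 * p) <= p * Q1 by rewrite ler_pM2l.
lra.
Qed.

Lemma famA1_lb M T : M \in flats l.+1 -> T \in flats t -> T \subset M ->
  (Q - 16^-1) * u * N1' <= Q * #|famA1 M T k t|%:R.
Proof.
move=> Ml Tt TM; have := card_famA1_ge (R := R) t0 tk tl hn Ml Tt TM.
set x := #|_|%:R => h; rewrite -(ler_pM2l Q1_gt0).
have gQ : 16 * Q * gb <= Q1.
  by apply: le_trans Q1_ge; rewrite ler_pM2l ?mulr_gt0 ?Q_gt0 // ltW // gb_lt.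
have := ler_wpM2l (ltW (Q_gt0 F)) h; rewrite [X in _ <= X -> _]mulrCA; apply: le_trans.
have u0 : 0 < u by rewrite u_split; have := gb_ge1; have := p_gt0; lra.
have uN : 0 <= u * N1' by rewrite mulr_ge0 // ltW.
have h2 : 0 <= (u * N1') * (Q1 - 16 * Q * gb) by rewrite mulr_ge0 // subr_ge0.
lra.
Qed.

(** The benchmark that the following upper bounds must stay below. The loss 1/16 is the relative
    error [l-t]_q / q^(n-k) of [card_famA1_ge], scaled by q and bounded by [Q1_ge]. *)
Lemma fam12_lb M T : M \in flats l.+1 -> T \in flats t -> T \subset M ->
  (Q - 16^-1) * u * N1' * N2 <= Q * (#|famA1 M T k t| * #|famA2 M T l t|)%:R.
Proof.
move=> Ml Tt TM; rewrite natrM mulrA; apply: ler_pM.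
- apply: mulr_ge0; last exact: ltW.
  by apply: mulr_ge0; [have := base_ge2; lra | exact: gnum_ge0].
- exact: ltW.
- exact: famA1_lb.
- exact: (card_famA2_ge t0 tk tl hn Ml Tt).
Qed.

Lemma two_covers_ub : Q * (N2 + Q ^+ 2 * g * N2') <= (Q + 32^-1) * N2.
Proof.
have : 32 * Q * (Q ^+ 2 * g) * N2' <= Q2 * N2' by rewrite ler_pM2r // Q2_ge_two_covers.
have := N2'_le; lra.
Qed.

Lemma product_lt (al be x1 x2 : R) : 0 <= x1 -> 0 <= x2 -> x1 <= al * N1' -> Q * x2 <= be * N2 ->
  al * be < (Q - 16^-1) * u -> Q * (x1 * x2) < (Q - 16^-1) * u * N1' * N2.
Proof.
move=> x10 x20 h1 h2 h3.
have h4 : x1 * (Q * x2) <= (al * N1') * (be * N2).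
  by apply: ler_pM => //; rewrite mulr_ge0 // ltW // Q_gt0.
rewrite mulrCA; apply: le_lt_trans h4 _.
rewrite (_ : al * N1' * (be * N2) = al * be * (N1' * N2)); last by ring.
by rewrite -(mulrA _ N1') ltr_pM2r // mulr_gt0.
Qed.

(** The factor u = gb + p shrinks to p; since Q gb >= p, the missing gb outweighs both error
    terms. *)
Lemma parallel_bound (x1 x2 : R) : 0 <= x1 -> 0 <= x2 ->
  x1 <= p * N1' -> x2 <= N2 + Q ^+ 2 * g * N2' ->
  Q * (x1 * x2) < (Q - 16^-1) * u * N1' * N2.
Proof.
move=> x10 x20 h1 h2; apply: product_lt h1 (le_trans _ two_covers_ub) _ => //.
  by rewrite ler_pM2l ?Q_gt0.
rewrite u_split; have := p_le_mul_gb; have := gb_lt; have := p_gt0; lra.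
Qed.

Lemma square_div_le : u * u / Q1 <= p / 8.
Proof. by rewrite ler_pdivrMr //; have := Q1_ge_square; lra. Qed.

(** Here u = gb + p shrinks to gb, up to an error of at most p/8. *)
Lemma few_covers_bound (x1 x2 : R) : 0 <= x1 -> 0 <= x2 ->
  x1 <= (gb + u * u / Q1) * N1' -> x2 <= N2 + Q ^+ 2 * g * N2' ->
  Q * (x1 * x2) < (Q - 16^-1) * u * N1' * N2.
Proof.
move=> x10 x20 h1 h2; apply: (@product_lt (gb + p / 8) (Q + 32^-1)) => //.
- by apply: le_trans h1 _; rewrite ler_pM2r // lerD2l square_div_le.
- by apply: le_trans two_covers_ub; rewrite ler_pM2l ?Q_gt0.
rewrite u_split; have := p_le_mul_gb; have := gb_lt; have := p_gt0; have := p_le_mul; lra.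
Qed.

Lemma one_cover_bound (x1 x2 : R) : 0 <= x1 -> 0 <= x2 ->
  x1 <= (1 + u * u / Q1) * N1' -> x2 <= N2 + Q * g * (v * N2') ->
  Q * (x1 * x2) < (Q - 16^-1) * u * N1' * N2.
Proof.
move=> x10 x20 h1 h2; apply: (@product_lt (1 + p / 8) (Q * (33 / 32))) => //.
- by apply: le_trans h1 _; rewrite ler_pM2r // lerD2l square_div_le.
- rewrite -mulrA ler_pM2l ?Q_gt0 //; apply: le_trans h2 _.
  have : 32 * (Q * g * v) * N2' <= Q2 * N2' by rewrite ler_pM2r // Q2_ge_one_cover.
  have := N2'_le; lra.
have h3 : 2 * gb <= Q * gb by rewrite ler_pM2r //; have := gb_ge1; lra.
have h4 : Q <= Q * gb by rewrite ler_peMr.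
have h5 : Q * 2 <= Q * p by rewrite ler_pM2l ?Q_gt0 // p_ge2.
rewrite u_split; have := p_le_mul; have := base_ge2; lra.
Qed.

(** Each unit of x + y costs at most q^(t+2) for choosing t-flats in a cover and gains q^e from
    climbing; two units already suffice. *)
Lemma far_bound (x1 x2 : R) x y : 0 <= x1 -> 0 <= x2 ->
  (2 <= x + y)%N -> (t + y <= k)%N -> (t + x <= l)%N ->
  x1 <= cnum F t x * (u ^+ y * nnum k (t + y)) ->
  x2 <= cnum F t y * (v ^+ x * nnum l (t + x)) ->
  Q * (x1 * x2) < (Q - 16^-1) * u * N1' * N2.
Proof.
move=> x10 x20 xy tyk txl h1 h2.
(* Chosen so that (l - t + 1) + e = n - k and (k - t + 1) + e = n - l: the net gain of one climbing
   step, in either family. *)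
pose e := (n + t - (k + l) - 1)%N.
have main (m m' y' x' : nat) z : (t < m')%N -> (m' + m + t + 7 <= n)%N ->
    (t + y' <= m)%N -> 0 <= z ->
    z <= cnum F t x' * (gnum (m' - t).+1 ^+ y' * nnum m (t + y')) ->
    e = (n + t - (m + m') - 1)%N ->
    z * Q ^+ (y' * e) <= Q ^+ ((t + 2) * x') * nnum m t.
  move=> tm' hm tym z0 hz ee.
  have N0 : 0 < nnum m (t + y') by apply: nnum_gt0; nlia.
  have ub : gnum (m' - t).+1 ^+ y' <= Q ^+ ((m' - t).+1 * y').
    by rewrite exprM lerXn2r ?nnegrE ?gnum_ge0 ?ltW ?expQ_gt0 ?gnum_lt.
  have hz2 : z <= Q ^+ ((t + 2) * x') * (Q ^+ ((m' - t).+1 * y') * nnum m (t + y')).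
    apply: le_trans hz _; apply: ler_pM; rewrite ?cnum_ge0 ?cnum_le //.
      by rewrite mulr_ge0 ?exprn_ge0 ?gnum_ge0 // ltW.
    by rewrite ler_pM2r.
  have dec : Q ^+ (y' * (n - m)) * nnum m (t + y') <= nnum m t by apply: nnum_decrX; nlia.
  have := ler_wpM2r (ltW (expQ_gt0 F (y' * e))) hz2 => hz3; apply: le_trans hz3 _.
  rewrite -mulrA ler_pM2l ?expQ_gt0 //; apply: le_trans dec.
  by rewrite mulrAC -exprD (_ : (m' - t).+1 * y' + y' * e = y' * (n - m))%N //; rewrite ee; nnia.
have b1 := main k l y x x1 tl ltac:(nlia) tyk x10 h1 erefl.
have b2 := main l k x y x2 tk ltac:(nlia) txl x20 h2 ltac:(rewrite /e; nlia).
have b3 : x1 * x2 * Q ^+ ((x + y) * e) <= Q ^+ ((t + 2) * (x + y)) * (N1 * N2).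
  rewrite (_ : x1 * x2 * _ = x1 * Q ^+ (y * e) * (x2 * Q ^+ (x * e))); last first.
    by rewrite mulnDl exprD; ring.
  rewrite (_ : _ * (N1 * N2) = Q ^+ ((t + 2) * x) * N1 * (Q ^+ ((t + 2) * y) * N2)); last first.
    by rewrite mulnDr exprD; ring.
  by apply: ler_pM => //; rewrite mulr_ge0 ?exprn_ge0 ?ler0n.
have b4 : x1 * x2 * Q ^+ (e + 2) <= N1 * N2.
  rewrite -(ler_pM2l (expQ_gt0 F ((t + 2) * (x + y)))); apply: le_trans b3.
  (* The inequality between exponents is (x + y)(e - t - 2) >= e + 2. For x + y = 2 it says e >= 2t
     + 6, which is exactly n >= k + l + t + 7. *)
  rewrite mulrCA -exprD ler_wpM2l ?mulr_ge0 //; apply: expQ_le.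
  by rewrite /e; nnia.
have b5 : Q * N1 < (Q - 16^-1) * u * N1' * Q ^+ (e + 2).
  have c1 : Q * p <= (Q - 16^-1) * u.
    by rewrite u_split; have := p_le_mul_gb; have := gb_lt; have := p_gt0; lra.
  have c2 : N1 < N1' * (p * Q ^+ (e + 2)).
    rewrite -exprD (_ : (l - t + (e + 2) = (n - k).+1)%N); last by rewrite /e; nlia.
    have ek : Q ^+ k = Q * Q ^+ k.-1 by rewrite -exprS prednK //; nlia.
    have en : Q ^+ (n - k).+1 * Q ^+ k.-1 = Q ^+ n by rewrite -exprD; congr (_ ^+ _); nlia.
    rewrite -(ltr_pM2r (expQ_gt0 F k.-1)) -[X in _ < X]mulrA en.
    have := nnumS (R := R) F (_ : (t < k <= n)%N) => /(_ ltac:(nlia)) eN.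
    have kt : Q ^+ t <= Q ^+ k.-1 by apply: expQ_le; nlia.
    have k1 : Q ^+ k.-1 <= Q ^+ k - Q ^+ t.
      rewrite ek; have : 2 * Q ^+ k.-1 <= Q * Q ^+ k.-1 by rewrite ler_pM2r ?expQ_gt0.
      lra.
    have := ler_wpM2r (ltW N1_gt0) k1; rewrite eN.
    have : 0 < Q ^+ t * N1' by rewrite mulr_gt0 ?expQ_gt0.
    lra.
  apply: (@lt_le_trans _ _ (Q * p * N1' * Q ^+ (e + 2))).
    rewrite (_ : Q * p * N1' * _ = Q * (N1' * (p * Q ^+ (e + 2)))); last by ring.
    by rewrite ltr_pM2l ?Q_gt0.
  by rewrite ler_pM2r ?expQ_gt0 // ler_pM2r.
rewrite -(ltr_pM2r (expQ_gt0 F (e + 2))); apply: (@le_lt_trans _ _ (Q * (N1 * N2))).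
  by rewrite -[X in X <= _]mulrA ler_pM2l ?Q_gt0.
rewrite [X in X < _]mulrA [X in _ < X]mulrAC ltr_pM2r //.
Qed.

(** Now [l-t+1]_q <= [t+1]_q, so the leading factor of (A3, A4) is larger by at least q. *)
Lemma fam12_lt_fam34 M T S : M \in flats l.+1 -> T \in flats t -> T \subset M ->
  S \in flats t.+1 -> (l <= 2 * t)%N ->
  (#|famA1 M T k t| * #|famA2 M T l t| < #|famA3 S k| * #|famA4 S l t|)%N.
Proof.
move=> Ml Tt TM St l2t; rewrite -(ltr_nat R) !natrM.
rewrite (card_famA3 tkn St) (card_famA4 tln St).
have h1 := card_famA1_le (R := R) t0 tk tl hn Ml Tt TM.
have h2 := card_famA2_le (R := R) t0 tk tl hn Ml Tt TM.
have ug : u <= g by apply: gnum_leS; nlia.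
rewrite -(ltr_pM2l (Q_gt0 F)) mulrCA.
have h3 : Q * #|famA2 M T l t|%:R <= (Q + 32^-1) * N2.
  by apply: le_trans two_covers_ub; rewrite ler_pM2l ?Q_gt0.
apply: (@le_lt_trans _ _ (g * N1' * ((Q + 32^-1) * N2))).
  apply: ler_pM => //; first by rewrite mulr_ge0 // ltW // Q_gt0.
  by apply: le_trans h1 _; rewrite ler_pM2r.
have h32 : 32 * N2' <= N2.
  apply: le_trans N2'_le; rewrite ler_pM2r //.
  apply: le_trans Q2_ge_two_covers; rewrite -[X in X <= _]mulr1 -mulrA ler_pM2l //.
  have := expQ_le (R := R) F (leq0n 2); rewrite expr0 => Q21.
  by rewrite !mulr_ege1 //; have := base_ge2; lra.
rewrite (_ : g * N1' * _ = N1' * (g * ((Q + 32^-1) * N2))); last by ring.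
rewrite [X in _ < X]mulrCA ltr_pM2l //.
have gN : 0 < g * N2 by rewrite mulr_gt0 //; have := g_ge1; lra.
have hQ : 2 * Q <= Q * Q by rewrite ler_pM2r ?Q_gt0.
have h5 : g * N2 * (Q + 32^-1) < g * N2 * (Q * Q * (31 / 32)).
  by rewrite ltr_pM2l //; have := base_ge2; lra.
have h6 : Q * Q * g * (N2 * (31 / 32)) <= Q * Q * g * (N2 - N2').
  by rewrite ler_pM2l ?mulr_gt0 //; lra.
have : 0 < Q * N2' by rewrite mulr_gt0 ?Q_gt0.
lra.
Qed.

Lemma fam34_lt_fam12 M T S : M \in flats l.+1 -> T \in flats t -> T \subset M ->
  S \in flats t.+1 -> (2 * t < l)%N ->
  (#|famA3 S k| * #|famA4 S l t| < #|famA1 M T k t| * #|famA2 M T l t|)%N.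
Proof.
move=> Ml Tt TM St l2t; rewrite -(ltr_nat R) !natrM.
rewrite (card_famA3 tkn St) (card_famA4 tln St).
have h1 := card_famA1_ge (R := R) t0 tk tl hn Ml Tt TM.
have h2 := card_famA2_ge (R := R) t0 tk tl hn Ml Tt.
have Qg : 1 <= Q * g by rewrite mulr_ege1 //; have := base_ge2; lra.
have h4 : Q * g * (N2 - N2') + N2' <= Q * g * N2.
  have := ler_wpM2r (ltW N2'_gt0) Qg; lra.
rewrite -(ltr_pM2l Q1_gt0) [X in _ < X]mulrA.
apply: (@lt_le_trans _ _ (u * ((Q1 - gb) * N1') * N2)); last first.
  apply: ler_pM => //; last exact: ltW.
  apply: mulr_ge0; first exact: gnum_ge0.
  apply: mulr_ge0; last exact: ltW.
  have h : 1 * p <= 16 * Q * p by rewrite ler_pM2r //; have := base_ge2; lra.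
  have := gb_lt; have := Q1_ge; lra.
apply: (@le_lt_trans _ _ (Q1 * (N1' * (Q * g * N2)))).
  by rewrite !ler_pM2l.
rewrite (_ : Q1 * _ = Q1 * (Q * g) * (N1' * N2)); last by ring.
rewrite (_ : u * _ * N2 = u * (Q1 - gb) * (N1' * N2)); last by ring.
rewrite ltr_pM2r; last exact: mulr_gt0.
suff : u * gb < Q1 * (u - Q * g) by lra.
rewrite gnum_mulQ.
have u0 : 0 < u by rewrite u_split; have := gb_ge1; have := p_gt0; lra.
(* For l = 2t + 1 the margin [l-t+1]_q - q [t+1]_q is only 1, and the size of q^(n-k) alone decides;
   otherwise the margin is at least q^(l-t). *)
have [bt|bt] : (l - t = t.+1 \/ t.+1 < l - t)%N by nlia.
  rewrite -bt subKr mulr1.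
  apply: (@lt_le_trans _ _ (Q ^+ ((l - t).+1 + (l - t)))); last by apply: expQ_le; nlia.
  by rewrite exprD; apply: ltr_pM; rewrite ?gnum_ge0 ?gnum_lt.
have gt2 : gnum t.+2 <= gb by apply: gnum_leS.
have h5 : Q1 * p <= Q1 * (u - (gnum t.+2 - 1)) by rewrite ler_pM2l // u_split; lra.
apply: lt_le_trans h5.
have h6 : 2 * p <= Q1.
  apply: le_trans Q1_ge; rewrite ler_pM2r //; have := base_ge2; lra.
apply: (@lt_le_trans _ _ (2 * p * p)); last by rewrite ler_pM2r.
by apply: ltr_pM; rewrite ?gnum_ge0 ?u_split //; have := gb_lt; lra.
Qed.

(** Both products have the same leading order, so the second-order terms decide: [wnum_swap] gives
    the difference exactly, with a factor q^k - q^l that is positive as l < k. *)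
Lemma fam12_swap_lt M T M' T' : M \in flats l.+1 -> T \in flats t -> T \subset M ->
  M' \in flats k.+1 -> T' \in flats t -> T' \subset M' -> (l < k)%N ->
  (#|famA1 M' T' l t| * #|famA2 M' T' k t| < #|famA1 M T k t| * #|famA2 M T l t|)%N.
Proof.
move=> Ml Tt TM Mk Tt' TM' lk; rewrite -(ltr_nat R) !natrM.
have hn' : (l + k + t + 7 <= n)%N by nlia.
have h1 := card_famA1_le (R := R) t0 tl tk hn' Mk Tt' TM'.
have h2 := card_famA2_le (R := R) t0 tl tk hn' Mk Tt' TM'.
have h3 := card_famA2_ge (R := R) t0 tk tl hn Ml Tt.
have e1 := card_famA1E (R := R) t0 tk tl hn Ml Tt TM.
have e2 := card_famA1E (R := R) t0 tl tk hn' Mk Tt' TM'.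
have sw := wnum_swap (ltnW tk) (ltnW tl).
set D1 := wnum k t l.+1 in e1 sw; set D2 := wnum l t k.+1 in e2 sw.
set X1 := #|famA1 M T k t|%:R in e1 *; set X2 := #|famA1 M' T' l t|%:R in e2 h1 *.
have X20 : 0 <= X2 by rewrite ler0n.
have X10 : 0 <= X1 by rewrite ler0n.
pose e := Q ^+ 2 * g * N1'.
apply: (@le_lt_trans _ _ (X2 * (N1 + e))); first by rewrite ler_wpM2l.
apply: (@lt_le_trans _ _ (X1 * N2)); last by rewrite ler_wpM2l.
have Q2g : 0 < Q ^+ 2 * g by apply: mulr_gt0 => //; exact: exprn_gt0.
have e0 : 0 < e by apply: mulr_gt0.
have X2v : Q2 * X2 <= v * N2.
  have v0 := gnum_ge0 (R := R) F (k - t).+1.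
  have := ler_wpM2l (ltW Q2_gt0) h1; have := ler_wpM2l v0 N2'_le; lra.
have v1 : 1 <= v by apply: gnum_ge1.
have eN : Q1 * e <= Q ^+ 2 * g * N1.
  by rewrite /e mulrCA ler_pM2l // N1'_le.
(* At least half of the l-flats through [T'] meet [M'] in [T'] alone. *)
have D2N : N2 <= 2 * D2.
  have v2 : 2 * v <= Q2.
    apply: ltW; apply: le_lt_trans Q2_gt_swap.
    have g3 : 1 <= Q ^+ 3 * g.
      by rewrite mulr_ege1 //; have := expQ_le (R := R) F (leq0n 3); rewrite expr0.
    have := ler_wpM2l (_ : 0 <= 2 * v) g3; rewrite mulr1 mulrA; apply; lra.
  have : 2 * (Q2 * X2) <= Q2 * N2.
    have := ler_wpM2r (ltW N2_gt0) v2; have := X2v; lra.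
  rewrite mulrCA ler_pM2l // e2; lra.
have Xn : Q ^+ n = Q1 * Q ^+ k by rewrite -exprD subnK //; nlia.
have kl : 2 * Q ^+ l <= Q ^+ k.
  apply: (@le_trans _ _ (Q ^+ l.+1)); last exact: expQ_le.
  by rewrite exprS ler_pM2r ?expQ_gt0.
have Ql0 := expQ_gt0 (R := R) F l; have Qk0 := expQ_gt0 (R := R) F k.
have nl : 0 < Q ^+ n - Q ^+ l by rewrite subr_gt0 expQ_lt //; nlia.
(* The gain [D2 * N1 - D1 * N2], known exactly, beats the loss [X2 * e]. *)
suff main : X2 * e * (Q ^+ n - Q ^+ l) < D2 * N1 * (Q ^+ k - Q ^+ l).
  have h : X2 * e * (Q ^+ n - Q ^+ l) < (D2 * N1 - D1 * N2) * (Q ^+ n - Q ^+ l).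
    by apply: lt_le_trans main _; move: sw; lra.
  rewrite ltr_pM2r // in h; move: h; rewrite e1 e2; lra.
apply: (@lt_le_trans _ _ (N2 * N1 * (Q ^+ k / 4))); last first.
  have f1 : N2 * N1 * (Q ^+ k / 4) <= (2 * D2) * N1 * (Q ^+ k / 4).
    by rewrite ler_pM2r ?ler_pM2r //; lra.
  have f2 : D2 * N1 * (Q ^+ k / 2) <= D2 * N1 * (Q ^+ k - Q ^+ l).
    by rewrite ler_pM2l; [lra | apply: mulr_gt0 => //; have := N2_gt0; lra].
  lra.
have b0 : X2 * e * (Q ^+ n - Q ^+ l) <= X2 * e * Q ^+ n.
  by apply: ler_wpM2l; [rewrite mulr_ge0 // ltW | rewrite gerBl ltW].
apply: le_lt_trans b0 _; rewrite -(ltr_pM2l Q2_gt0).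
rewrite (_ : Q2 * _ = (Q2 * X2) * (Q1 * e) * Q ^+ k); last by rewrite Xn; ring.
rewrite (_ : Q2 * (N2 * N1 * _) = (Q2 / 4) * (N2 * N1) * Q ^+ k); last by ring.
rewrite ltr_pM2r //.
apply: (@le_lt_trans _ _ ((v * N2) * (Q ^+ 2 * g * N1))).
  by apply: ler_pM => //; rewrite mulr_ge0 // ltW.
rewrite (_ : v * N2 * _ = v * Q ^+ 2 * g * (N2 * N1)); last by ring.
rewrite ltr_pM2r; last exact: mulr_gt0.
have vg : 0 < v * g by apply: mulr_gt0 => //; lra.
have vgQ : 0 <= v * g * Q ^+ 2 by apply/ltW/mulr_gt0 => //; exact: exprn_gt0.
have h5 := ler_wpM2l vgQ base_ge2.
have := Q2_gt_swap; rewrite (exprS _ 2); lra.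
Qed.

(** By [nnumS], N(k,t+1) / N(k,t) = (q^k - q^t) / (q^n - q^t), which increases with k. *)
Lemma fam34_swap_lt S S' : S \in flats t.+1 -> S' \in flats t.+1 -> (l < k)%N ->
  (#|famA3 S' l| * #|famA4 S' k t| < #|famA3 S k| * #|famA4 S l t|)%N.
Proof.
move=> St St' lk; rewrite -(ltr_nat R) !natrM.
have hn' : (l + k + t + 7 <= n)%N by nlia.
rewrite (card_famA3 tkn St) (card_famA4 tln St).
rewrite (card_famA3 tln St') (card_famA4 tkn St').
suff h : N2' * N1 < N1' * N2.
  have Qg : 0 < Q * g by exact: mulr_gt0.
  have : (Q * g) * (N2' * N1) < (Q * g) * (N1' * N2) by rewrite ltr_pM2l.
  lra.
have nt : 0 < Q ^+ n - Q ^+ t by rewrite subr_gt0 expQ_lt //; nlia.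
have s1 := nnumS (R := R) F tkn; have s2 := nnumS (R := R) F tln.
rewrite -(ltr_pM2l nt) [X in X < _]mulrA [X in _ < X]mulrA -s1 -s2 [X in X < _]mulrAC.
by rewrite ltr_pM2r // ltr_pM2r // ltrD2r expQ_lt.
Qed.

End Numerics.

End Comparisons.

(** * Cross-intersecting pairs with large and with small covers *)

Section Structure.
Context {R : realFieldType}.
Variables (F : finFieldType) (n : nat).
Local Notation V := 'rV[F]_n.
Local Notation q := #|F|.
Local Notation Q := (#|F|%:R%R : R).
Local Notation gnum := (@gnum R F).
Local Notation nnum := (@nnum R F n).
Implicit Types (A B M S T X : {set V}).

Lemma leq_card_bigcup (I : finType) (T : finType) (P : {set I}) (f : I -> {set T}) :
  #|\bigcup_(i in P) f i| <= \sum_(i in P) #|f i|.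
Proof.
elim/big_rec2: _ => [|i m s _ h]; first by rewrite cards0.
by apply: leq_trans (leq_card_setU _ _) _; rewrite leq_add2l.
Qed.

Section PairOfFamilies.
Variables (k l t : nat) (G H : {set {set V}}).
Hypotheses (t0 : 0 < t) (tk : t < k) (tl : t < l) (hn : k + l + t + 7 <= n).
Hypotheses (Gk : G \subset flats k) (Hl : H \subset flats l).
Hypothesis GH : forall A B, A \in G -> B \in H -> q ^ t <= #|A :&: B|.

Let fG A : A \in G -> flat A. Proof. by move=> /(subsetP Gk) /flats_flat. Qed.
Let fH B : B \in H -> flat B. Proof. by move=> /(subsetP Hl) /flats_flat. Qed.

(** [chain_cover] distributes [G] over the t-flats of [X1], and [chain_noncover] climbs from each of
    them to dimension t + y, below which nothing covers [H]. The same holds with the roles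
    exchanged. *)
Lemma far_families M T X1 X2 x y : M \in flats l.+1 -> T \in flats t -> T \subset M ->
  X1 \in flats (t + x) -> X2 \in flats (t + y) -> t + y <= k -> t + x <= l -> 2 <= x + y ->
  (forall A, A \in G -> q ^ t <= #|A :&: X1|) ->
  (forall B, B \in H -> q ^ t <= #|B :&: X2|) ->
  (forall s S, s < t + y -> S \in flats s -> exists2 B, B \in H & #|S :&: B| < q ^ t) ->
  (forall s S, s < t + x -> S \in flats s -> exists2 A, A \in G & #|S :&: A| < q ^ t) ->
  #|G| * #|H| < #|famA1 M T k t| * #|famA2 M T l t|.
Proof.
move=> Ml Tt TM X1t X2t tyk txl xy cG cH minH minG.
rewrite -(ltr_nat R) -(ltr_pM2l (Q_gt0 F)).
apply: lt_le_trans (fam12_lb t0 tk tl hn Ml Tt TM).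
have tyk' : t + y <= k <= n by nlia.
have txl' : t + x <= l <= n by nlia.
have tl' : 0 < t <= l by nlia.
have tk' : 0 < t <= k by nlia.
rewrite natrM; apply: (far_bound t0 tk tl hn _ _ xy tyk txl); rewrite ?ler0n //.
  apply: (chain_cover Gk X1t) => //.
    by rewrite mulr_ge0 ?exprn_ge0 ?gnum_ge0 // ltW // nnum_gt0.
  move=> A At _; have := chain_noncover (R := R) Gk Hl tl' tyk' GH minH (leq_addr y t) At.
  by rewrite addKn.
apply: (chain_cover Hl X2t) => //.
  by rewrite mulr_ge0 ?exprn_ge0 ?gnum_ge0 // ltW // nnum_gt0.
move=> A At _.
have HG B A' : B \in H -> A' \in G -> q ^ t <= #|B :&: A'| by move=> *; rewrite setIC GH.
have := chain_noncover (R := R) Hl Gk tk' txl' HG minG (leq_addr x t) At.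
by rewrite addKn.
Qed.

Section OneCenter.
Variables (T B0 S0 : {set V}).
Hypothesis clG : forall A, A \in flats k -> (forall B, B \in H -> q ^ t <= #|A :&: B|) -> A \in G.
Hypotheses (Tt : T \in flats t) (TG : forall A, A \in G -> T \subset A).
Hypotheses (B0H : B0 \in H) (TB0 : ~~ (T \subset B0)).

Let covers := [set S in flats t.+1 | [forall B in H, q ^ t <= #|S :&: B|]].
Hypothesis S0c : S0 \in covers.

Let coversP S : S \in covers -> S \in flats t.+1 /\ (forall B, B \in H -> q ^ t <= #|S :&: B|).
Proof. by rewrite in_set => /andP[-> /forall_inP]. Qed.

(** A k-flat through the cover [S] that misses a point of [T] would belong to [G] by closure,
    although every member of [G] contains [T]. *)
Let T_cover S : S \in covers -> T \subset S.
Proof.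
move=> /coversP[St cS]; apply/subsetP=> x xT; apply/negPn/negP => xS.
have tkn : t.+1 <= k < n by nlia.
have [C [Ck SC _ xC]] := flats_avoid St (setT_flats F n) (subsetT S) (in_setT x) xS tkn.
case/negP: xC; apply: (subsetP (TG _)) => //; apply: clG => // B BH.
exact: leq_trans (cS B BH) (subset_leq_card (setSI _ SC)).
Qed.

Let cap_T B : B \in H -> ~~ (T \subset B) -> #|T :&: B| < q ^ t.
Proof.
move=> BH TB; rewrite setIC; apply: leq_ltn_trans (flat_cap_small (fH BH) Tt TB t0) _.
by rewrite ltn_exp2l ?(q_gt1 F) // ltn_predL.
Qed.

(* Every [(t+1)]-dimensional cover [S] is spanned by [T] and a [t]-flat of [B]. *)
Let hullB B : B \in H -> ~~ (T \subset B) ->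
  exists M, [/\ M \in flats l.+1, B \subset M & forall S, S \in covers -> S \subset M].
Proof.
move=> BH /subsetPn[y yT yB]; have Bl := subsetP Hl _ BH.
have jl := join_flats Bl yB; have fj := flats_flat jl.
exists (join B y); split => //; first exact: sub_join.
move=> S cS; have [St /(_ B BH) SB] := coversP cS.
have yS : y \in S by apply: (subsetP (T_cover cS)).
have [x] : exists x, x \in S :&: B.
  by apply/set0Pn; rewrite -card_gt0; apply: leq_trans SB; rewrite expq_gt0.
rewrite inE => /andP[xS xB].
have /flatP[c Ic] := flatI (flats_flat St) (fH BH) xS xB.
have c1 := flats_leq_sub Ic St (subsetIl _ _).
have c2 : t <= c by move: SB; rewrite (card_flats Ic) leq_exp2l // (q_gt1 F).
have c3 : c != t.+1.
  apply: contraNneq yB => ec; rewrite ec in Ic.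
  by have := flats_sub_eq Ic St (subsetIl _ _) => eS; move: yS; rewrite -eS inE => /andP[].
have ec : c = t by apply/eqP; rewrite eqn_leq c2 andbT -ltnS ltn_neqAle c3.
rewrite ec in Ic; rewrite -(join_eq Ic St (subsetIl _ _) yS) ?inE ?negb_and ?yB ?orbT //.
by rewrite join_sub // join_mem (subset_trans (subsetIr _ _)) ?sub_join.
Qed.

(** As [T :&: B] is too small, [A :&: B] has a point outside [T]; together with [T] it spans a
    (t+1)-flat inside [A :&: M]. *)
Let G_meets M B : B \in H -> ~~ (T \subset B) -> M \in flats l.+1 -> B \subset M -> T \subset M ->
  forall A, A \in G -> q ^ t.+1 <= #|A :&: M|.
Proof.
move=> BH TB Ml BM TM A AG.
have [x xAB xT] : exists2 x, x \in A :&: B & x \notin T.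
  apply/subsetPn; apply/negP => ABT.
  have : A :&: B \subset T :&: B by rewrite subsetI ABT subsetIr.
  by move/subset_leq_card; rewrite leqNgt (leq_trans (cap_T BH TB)) // GH.
move: xAB; rewrite inE => /andP[xA xB].
rewrite -(card_flats (join_flats Tt xT)) subset_leq_card // subsetI.
by rewrite (join_sub _ _ (fG AG)) (join_sub _ _ (flats_flat Ml)) xA TG // (subsetP BM _ xB).
Qed.

Let supT : sup G T = G.
Proof. by apply/setP=> A; rewrite in_sup; have [/TG ->|] := boolP (A \in G). Qed.

Local Open Scope ring_scope.

(** Members through some cover give the first term. For the others, neither [T] nor any relevant
    (t+1)-flat above it covers [H], so two climbing steps apply and lead to (t+2)-flats. *)
Let G_le : #|G|%:R <= (#|covers|%:R + gnum (l - t).+1 * gnum (l - t).+1 / Q ^+ (n - k)) *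
  nnum k t.+1.
Proof.
have tkn : (t.+1 <= k <= n)%N by nlia.
have N0 := nnum_gt0 (R := R) F tkn.
pose rest := [set A in G | [forall S in covers, ~~ (S \subset A)]].
have restG : rest \subset G by apply/subsetP=> A; rewrite inE => /andP[].
have restk := subset_trans restG Gk.
have h : (#|G| <= #|rest| + \sum_(S in covers) #|sup G S|)%N.
  apply: leq_trans (_ : (#|rest :|: \bigcup_(S in covers) sup G S| <= _)%N).
    apply: subset_leq_card; apply/subsetP=> A AG; rewrite in_setU inE AG /=.
    have [//|/forall_inPn[S cS]] := boolP [forall S in covers, ~~ (S \subset A)].
    by rewrite negbK => SA; apply/bigcupP; exists S; rewrite // in_sup AG.
  apply: leq_trans (leq_card_setU _ _) _; rewrite leq_add2l; exact: leq_card_bigcup.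
have h1 : (\sum_(S in covers) #|sup G S|)%:R <= #|covers|%:R * nnum k t.+1.
  rewrite natr_sum mulr_natl -sumr_const; apply: ler_sum => S cS.
  by have [St _] := coversP cS; apply: (card_sup_le Gk tkn).
have h2 : #|rest|%:R <= gnum (l - t).+1 * (gnum (l - t).+1 * (nnum k t.+1 / Q ^+ (n - k))).
  have -> : rest = sup rest T.
    by apply/setP=> A; rewrite in_sup; have [/(subsetP restG) /TG ->|] := boolP (A \in rest).
  have tl' : (0 < t <= l)%N by nlia.
  have B1 : 0 <= nnum k t.+1 / Q ^+ (n - k) by rewrite divr_ge0 // ltW // expQ_gt0.
  have B2 : 0 <= gnum (l - t).+1 * (nnum k t.+1 / Q ^+ (n - k)) by rewrite mulr_ge0 ?gnum_ge0.
  apply: (sup_noncover_le restk Tt (subsetP Hl _ B0H) tl' _ (cap_T B0H TB0) B2).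
    by move=> A /(subsetP restG) AG; apply: GH.
  move=> Y Yt TY; have [cY|] := boolP (Y \in covers).
    have -> : sup rest Y = set0; last by rewrite cards0.
    apply/setP=> A; rewrite in_sup inE in_set0; apply/negP => /andP[/andP[_ /forall_inP nA] YA].
    by have := nA _ cY; rewrite YA.
  rewrite in_set Yt /= => /forall_inPn[B BH]; rewrite -ltnNge => YB.
  apply: (sup_noncover_le restk Yt (subsetP Hl _ BH) tl' _ YB B1).
    by move=> A /(subsetP restG) AG; apply: GH.
  by move=> Z Zt _; apply: (sup_le_div restk tkn Zt).
rewrite -(ler_nat R) natrD in h; apply: le_trans h _; rewrite mulrDl addrC lerD //.
by apply: le_trans h2 _; rewrite le_eqVlt; apply/orP; left; apply/eqP; ring.
Qed.

Let H_split (b : R) : #|[set B in H | ~~ (T \subset B)]|%:R <= b -> #|H|%:R <= nnum l t + b.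
Proof.
move=> hb; have tln : (t <= l <= n)%N by nlia.
apply: le_trans (lerD (card_sup_le Hl tln Tt) hb).
rewrite -natrD ler_nat; apply: leq_trans (leq_card_setU _ _).
apply: subset_leq_card; apply/subsetP=> B BH; rewrite in_setU in_sup inE BH /=.
by case: (T \subset B).
Qed.

(** The case analysis is on whether the cover is unique and, if not, on whether all members of [H]
    that avoid containing [T] lie in one (l+1)-flat and meet [T]. Every configuration other than the
    two models loses a definite part of the benchmark. *)
Lemma one_center_families M0 T0 :
  M0 \in flats l.+1 -> T0 \in flats t -> T0 \subset M0 ->
  [\/ exists M, [/\ M \in flats l.+1, T \subset M, G \subset famA1 M T k t &
        H \subset famA2 M T l t],
      exists S, [/\ S \in flats t.+1, G \subset famA3 S k & H \subset famA4 S l t] |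
      (#|G| * #|H| < #|famA1 M0 T0 k t| * #|famA2 M0 T0 l t|)%N].
Proof.
move=> M0l T0t TM0.
have bound : Q * (#|G|%:R * #|H|%:R) < (Q - 16^-1) * gnum (l - t).+1 * nnum k t.+1 * nnum l t ->
    (#|G| * #|H| < #|famA1 M0 T0 k t| * #|famA2 M0 T0 l t|)%N.
  move=> h; rewrite -(ltr_nat R) -(ltr_pM2l (Q_gt0 F)) natrM.
  exact: lt_le_trans h (fam12_lb t0 tk tl hn M0l T0t TM0).
pose H' := [set B in H | ~~ (T \subset B)].
have H'l : H' \subset flats l.
  by apply: subset_trans Hl; apply/subsetP=> B; rewrite inE => /andP[].
have [S0t cS0] := coversP S0c; have TS0 := T_cover S0c.
have tln : (t.+1 <= l <= n)%N by nlia.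
have tkn : (t.+1 <= k <= n)%N by nlia.
have N20 := nnum_gt0 (R := R) F tln.
have [only|/subsetPn[S1 S1c]] := boolP (covers \subset [set S0]); last first.
  rewrite in_set1 eq_sym => S01; have [S1t cS1] := coversP S1c; have TS1 := T_cover S1c.
  have H_le : #|H|%:R <= nnum l t + Q ^+ 2 * gnum t.+1 * nnum l t.+1.
    apply: H_split; apply: (two_covers_le _ _ H'l Tt S0t S1t TS0 TS1 S01); try by nlia.
    by move=> B; rewrite inE => /andP[BH TB]; rewrite TB !(setIC B) cS0 ?cS1.
  have [M [Ml B0M cM]] := hullB B0H TB0.
  have TM : T \subset M by apply: subset_trans TS0 (cM _ S0c).
  have [inM|/forall_inPn[B1 B1H]] := boolP [forall B in H, (T \subset B) || (B \subset M)].
    have [meetT|/forall_inPn[B2]] := boolP [forall B in H', B :&: T != set0].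
      constructor 1; exists M; split=> //; apply/subsetP.
        move=> A AG; rewrite in_famA1 ?(flats_flat Ml) // (subsetP Gk) // TG //.
        exact: (G_meets B0H TB0).
      move=> B BH; rewrite in_famA2 ?(flats_flat Tt) // (subsetP Hl) //=.
      have := forall_inP inM _ BH; have [//|TB /= BM] := boolP (T \subset B).
      rewrite BM eqn_leq flat_cap_small ?fH //=.
      have nz : B :&: T != set0 by apply: (forall_inP meetT); rewrite inE BH.
      have := hyperplane_cap (subsetP Hl _ BH) Ml BM (flats_flat Tt) TM nz.
      by rewrite (card_flats Tt) -{1}(prednK t0) expnS leq_pmul2l ?(q_gt0 F) // setIC.
    rewrite inE => /andP[B2H TB2]; rewrite negbK => /eqP B2T.
    constructor 3; apply: bound.
    apply: (parallel_bound t0 tk tl hn _ _ _ H_le); rewrite ?ler0n //.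
    (* [B2] is disjoint from [T], so all of its q^l points count, at least q^t of them on each
       member of [G]; this gives the factor q^(l-t). *)
    have Qt := expQ_gt0 (R := R) F t; rewrite -(ler_pM2l Qt) mulrA -exprD subnKC; last by nlia.
    have e2 : B2 :\: T = B2 by apply/setDidPl; rewrite -setI_eq0 B2T.
    have := @sup_step_le R F n G k T B2 (Q ^+ t) (nnum k t.+1) Gk.
    rewrite e2 supT (card_flats (subsetP Hl _ B2H)) natrX; apply.
      by move=> A AG _; rewrite -natrX ler_nat GH.
    by move=> y _ yT; apply: (card_sup_le Gk tkn (join_flats Tt yT)).
  rewrite negb_or => /andP[TB1 B1M]; constructor 3; apply: bound.
  apply: (few_covers_bound t0 tk tl hn _ _ _ H_le); rewrite ?ler0n //.
  apply: le_trans G_le _; rewrite ler_pM2r ?(nnum_gt0 F tkn) // lerD2r.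
  have [M1 [M1l B1M1 cM1]] := hullB B1H TB1.
  have TM1 : T \subset M1 by apply: subset_trans TS0 (cM1 _ S0c).
  have [x xT] := flats_point Tt.
  have fM := flats_flat Ml; have fM1 := flats_flat M1l.
  (* All covers lie in both hulls [M] and [M1], whose intersection has dimension at most l; hence
     there are at most [l-t]_q of them. *)
  have /flatP[c Yc] := flatI fM fM1 (subsetP TM _ xT) (subsetP TM1 _ xT).
  have cl : (c <= l)%N.
    rewrite -ltnS ltn_neqAle (flats_leq_sub Yc Ml (subsetIl _ _)) andbT.
    apply: contraNneq B1M => ec; rewrite ec in Yc.
    by rewrite -(flats_sub_eq Yc Ml (subsetIl _ _)) (flats_sub_eq Yc M1l (subsetIr _ _)).
  have S0Y : S0 \subset M :&: M1 by rewrite subsetI cM ?cM1.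
  have tc := flats_leq_sub S0t Yc S0Y.
  have covk : covers \subset flats t.+1 by apply/subsetP=> S /coversP[].
  have -> : covers = sup covers T.
    by apply/setP=> S; rewrite in_sup; have [/T_cover ->|] := boolP (S \in covers).
  apply: le_trans (gnum_leS F (_ : c - t <= l - t)%N); last by nlia.
  rewrite -[gnum _]mulr1 (_ : (c - t = (c - t.+1).+1)%N); last by nlia.
  apply: (sup_noncover_le covk Tt Yc) => //.
  - move=> S cS; have [St _] := coversP cS.
    have SY : S \subset M :&: M1 by rewrite subsetI cM ?cM1.
    by rewrite (setIidPl SY) (card_flats St).
  - apply: leq_ltn_trans (subset_leq_card (subsetIl _ _)) _.
    by rewrite (card_flats Tt) ltn_exp2l ?(q_gt1 F).
  - move=> Y Yt _; rewrite (@ler_nat R _ 1); apply: leq_trans (_ : (#|[set Y]| <= 1)%N).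
      apply: subset_leq_card; apply/subsetP=> S; rewrite in_sup in_set1 => /andP[cS YS].
      by have [St _] := coversP cS; rewrite (flats_sub_eq Yt St YS).
    by rewrite cards1.
have cov1 : #|covers|%:R = 1 :> R.
  suff -> : covers = [set S0] by rewrite cards1.
  by apply/eqP; rewrite eqEsubset only sub1set.
have [allG|/forall_inPn[A0 A0G SA0]] := boolP [forall A in G, S0 \subset A].
  constructor 2; exists S0; split=> //; apply/subsetP.
    by move=> A AG; rewrite in_famA3 (subsetP Gk) // (forall_inP allG).
  by move=> B BH; rewrite in_famA4 ?(flats_flat S0t) // (subsetP Hl) // setIC cS0.
constructor 3; apply: bound; apply: (one_cover_bound t0 tk tl hn); rewrite ?ler0n //.
  by have := G_le; rewrite cov1.
apply: H_split; rewrite -cnum1; have S0t1 := S0t; rewrite -(addn1 t) in S0t1.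
have vN : 0 <= gnum (k - t).+1 * nnum l t.+1 by rewrite mulr_ge0 ?gnum_ge0 // ltW.
apply: (chain_cover H'l S0t1 _ vN).
  by move=> B; rewrite inE => /andP[BH _]; rewrite setIC cS0.
move=> Y Yt YS0; have [YT|YT] := eqVneq Y T.
  have -> : sup H' Y = set0; last by rewrite cards0.
  by apply/setP=> B; rewrite in_sup inE in_set0 YT; case: (T \subset B); rewrite ?andbF.
(* [T] and any other t-flat [Y] of [S0] span [S0], so [A0], which contains [T] but not [S0], shows
   that [Y] is no cover of [G]. *)
have YA0 : ~~ (Y \subset A0).
  apply: contra SA0 => YA0; have [y yY yT] : exists2 y, y \in Y & y \notin T.
    by apply/subsetPn; apply: contraNN YT => YT; rewrite (flats_sub_eq Yt Tt YT).
  rewrite -(join_eq Tt S0t TS0 (subsetP YS0 _ yY) yT) join_sub ?fG //.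
  by rewrite (subsetP YA0) // TG.
have tk' : (0 < t <= k)%N by nlia.
apply: (sup_noncover_le H'l Yt (subsetP Gk _ A0G) tk') => //.
- by move=> B; rewrite inE => /andP[BH _]; rewrite setIC GH.
- rewrite setIC; apply: leq_ltn_trans (flat_cap_small (fG A0G) Yt YA0 t0) _.
  by rewrite ltn_exp2l ?(q_gt1 F) // ltn_predL.
- by rewrite ltW.
- by move=> Z Zt _; apply: (card_sup_le H'l tln Zt).
Qed.

End OneCenter.
End PairOfFamilies.
End Structure.

(** * The model pairs are non-trivial and cross t-intersecting *)

Section Models.
Variables (F : finFieldType) (n k l t : nat).
Local Notation V := 'rV[F]_n.
Local Notation q := #|F|.
Implicit Types (A B M S T : {set V}) (G H : {set {set V}}).

Lemma cross_intersectingP G H : G \subset flats k -> H \subset flats l ->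
  cross_intersecting t G H <-> forall A B, A \in G -> B \in H -> q ^ t <= #|A :&: B|.
Proof.
move=> Gk Hl; split=> GH A B AG BH; have := GH A B AG BH;
  by rewrite flat_capP // ?(flats_flat (subsetP Gk _ AG)) ?(flats_flat (subsetP Hl _ BH)).
Qed.

Lemma nontrivial_sym G H : nontrivial_cross_intersecting k l t G H ->
  nontrivial_cross_intersecting l k t H G.
Proof.
case=> Gk Hl GH triv; split=> //.
  by move=> B A BH AG; rewrite setIC; apply: GH.
by case=> T Tt [TH TG]; apply: triv; exists T.
Qed.

Hypotheses (t0 : 0 < t) (tk : t < k) (tl : t < l) (hn : k + l + t + 7 <= n).

Lemma fam12_nontrivial M T : M \in flats l.+1 -> T \in flats t -> T \subset M ->
  nontrivial_cross_intersecting k l t (famA1 M T k t) (famA2 M T l t).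
Proof.
move=> Ml Tt TM; have fM := flats_flat Ml; have fT := flats_flat Tt.
split; [exact: sub_famA1 | exact: sub_famA2 | |].
  apply/cross_intersectingP; [exact: sub_famA1 | exact: sub_famA2 |] => A B.
  rewrite in_famA1 // in_famA2 // => /and3P[Ak TA AM] /andP[Bl /orP[TB|/andP[BM /eqP BT]]].
    by rewrite -(card_flats Tt) subset_leq_card // subsetI TA.
  have [x] : exists x, x \in B :&: T by apply/set0Pn; rewrite -card_gt0 BT expq_gt0.
  rewrite inE => /andP[xB xT].
  have fA := flats_flat Ak; have xA := subsetP TA _ xT.
  have fI := flatI fA fM xA (subsetP TM _ xT).
  have nz : B :&: (A :&: M) != set0.
    by apply/set0Pn; exists x; rewrite !inE xB xA (subsetP TM).
  have := hyperplane_cap Bl Ml BM fI (subsetIr _ _) nz.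
  move=> /(leq_trans AM); rewrite expnS leq_pmul2l ?(q_gt0 F) // => h.
  by apply: leq_trans h (subset_leq_card _); rewrite setSI ?subsetIl.
case=> T' Tt' [_ T'H].
(* Flats through [T] can miss any point outside [T], so the common t-flat would be [T] itself; a
   hyperplane of [M] through a (t-1)-flat of [T], but not through [T], refutes this. *)
have T'T : T' \subset T.
  apply/subsetP=> x xT'; apply/negPn/negP => xT.
  have tln : t <= l < n by nlia.
  have [B [Bl TB _ xB]] := flats_avoid Tt (setT_flats F n) (subsetT _) (in_setT x) xT tln.
  by case/negP: xB; apply: (subsetP (T'H B _)) => //; rewrite in_famA2 // Bl TB.
have [x xT] := flats_point Tt.
have tt : 0 <= t.-1 <= t by nlia.
have sx : [set x] \subset T by rewrite sub1set.
have [T0 [T0t _ T0T]] := flats_between (set1_flats x) Tt sx tt.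
have tt' : t.-1 < t by nlia.
have [y yT yT0] := flats_proper_point T0t Tt tt'.
have tl' : t.-1 <= l < l.+1 by nlia.
have [B [Bl T0B BM yB]] := flats_avoid T0t Ml (subset_trans T0T TM) (subsetP TM _ yT) yT0 tl'.
have TB : ~~ (T \subset B) by apply: contra yB => /subsetP; apply.
have BA : B \in famA2 M T l t.
  rewrite in_famA2 // Bl BM /= eqn_leq (flat_cap_small (flats_flat Bl)) //=.
  by rewrite -(card_flats T0t) subset_leq_card ?orbT // subsetI T0B.
by case/negP: TB; rewrite -(flats_sub_eq Tt' Tt T'T) T'H.
Qed.

Lemma fam34_nontrivial S : S \in flats t.+1 ->
  nontrivial_cross_intersecting k l t (famA3 S k) (famA4 S l t).
Proof.
move=> St; have fS := flats_flat St.
split; [exact: sub_famA3 | exact: sub_famA4 | |].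
  apply/cross_intersectingP; [exact: sub_famA3 | exact: sub_famA4 |] => A B.
  rewrite in_famA3 in_famA4 // => /andP[_ SA] /andP[_ SB].
  by apply: leq_trans SB (subset_leq_card _); rewrite setIC setSI.
case=> T' Tt' [T'G T'H].
have [x xT'] := flats_point Tt'.
have xS : x \in S.
  apply/negPn/negP => xS; have tkn : t.+1 <= k < n by nlia.
  have [A [Ak SA _ xA]] := flats_avoid St (setT_flats F n) (subsetT _) (in_setT x) xS tkn.
  by case/negP: xA; apply: (subsetP (T'G A _)) => //; rewrite in_famA3 Ak SA.
(* The point [y] starts a t-flat of [S] that avoids [x]; a member of A4 through this t-flat can
   avoid [x] as well. *)
have [y yS yx] := flats_proper_point (set1_flats x) St (ltn0Sn t).
have xy : x \notin [set y] by move: yx; rewrite !in_set1 eq_sym.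
have tt : 0 <= t < t.+1 by nlia.
have sy : [set y] \subset S by rewrite sub1set.
have [T0 [T0t _ T0S xT0]] := flats_avoid (set1_flats y) St sy xS xy tt.
have tln : t <= l < n by nlia.
have [B [Bl TB _ xB]] := flats_avoid T0t (setT_flats F n) (subsetT _) (in_setT x) xT0 tln.
case/negP: xB; apply: (subsetP (T'H B _)) => //; rewrite in_famA4 // Bl /=.
by rewrite -(card_flats T0t) subset_leq_card // subsetI TB.
Qed.

End Models.

(** * Maximum pairs and the final case analysis *)

Section MaximumPairs.
Variables (F : finFieldType) (n k l t : nat).
Local Notation V := 'rV[F]_n.
Local Notation q := #|F|.
Implicit Types (A B M S T : {set V}) (G H : {set {set V}}).

Lemma subpair_eq (T : finType) (G H G' H' : {set T}) : G \subset G' -> H \subset H' ->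
  #|G'| * #|H'| <= #|G| * #|H| -> 0 < #|G| * #|H| -> G = G' /\ H = H'.
Proof.
have key a b c d : a <= c -> b <= d -> c * d <= a * b -> 0 < a -> 0 < b -> c <= a /\ d <= b.
  by clear; nia.
move=> GG HH le; rewrite muln_gt0 => /andP[G0 H0].
have [c1 c2] := key _ _ _ _ (subset_leq_card GG) (subset_leq_card HH) le G0 H0.
by split; apply/eqP; rewrite eqEcard ?GG ?HH.
Qed.

Definition maximum_pair G H := nontrivial_cross_intersecting k l t G H /\
  forall G' H', nontrivial_cross_intersecting k l t G' H' -> #|G'| * #|H'| <= #|G| * #|H|.

(** Adding [A] keeps the pair cross-intersecting and non-trivial, so maximality allows no growth. *)
Lemma maximum_closed G H A : maximum_pair G H -> 0 < #|G| * #|H| -> A \in flats k ->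
  (forall B, B \in H -> q ^ t <= #|A :&: B|) -> A \in G.
Proof.
case=> [[Gk Hl GH triv] maxGH] pos Ak AH.
have AGk : A |: G \subset flats k by rewrite subUset sub1set Ak.
have /maxGH le : nontrivial_cross_intersecting k l t (A |: G) H.
  split=> //.
    move/(cross_intersectingP _ Gk Hl): GH => GH; apply/(cross_intersectingP _ AGk Hl).
    by move=> A' B; rewrite in_setU1 => /orP[/eqP ->|A'G] BH; [apply: AH | apply: GH].
  case=> T Tt [TG TH]; apply: triv; exists T => //; split=> // A' A'G.
  by apply: TG; rewrite in_setU1 A'G orbT.
have [-> _] := subpair_eq (subsetUr [set A] G) (subxx H) le pos.
by rewrite setU11.
Qed.

(** Any member of [G] covers [H], so a least covering dimension exists and is at most k; it is at
    least t because [H] is nonempty. *)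
Lemma min_cover G H : G \subset flats k -> H \subset flats l -> 0 < #|G| -> 0 < #|H| ->
  (forall A B, A \in G -> B \in H -> q ^ t <= #|A :&: B|) ->
  exists y X, [/\ X \in flats (t + y), t + y <= k,
    forall B, B \in H -> q ^ t <= #|X :&: B| &
    forall s S, s < t + y -> S \in flats s -> exists2 B, B \in H & #|S :&: B| < q ^ t].
Proof.
move=> Gk Hl /card_gt0P[A0 A0G] /card_gt0P[B0 B0H] GH.
pose P s := [exists X in flats s, [forall B in H, q ^ t <= #|X :&: B|]].
have exP : exists s, P s.
  exists k; apply/exists_inP; exists A0; first exact: (subsetP Gk).
  by apply/forall_inP => B; apply: GH.
have [s Ps mins] := ex_minnP exP.
have sk : s <= k.
  apply: mins; apply/exists_inP; exists A0; first exact: (subsetP Gk).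
  by apply/forall_inP => B; apply: GH.
have /exists_inP[X Xs /forall_inP XH] := Ps.
have ts : t <= s.
  have := leq_trans (XH _ B0H) (subset_leq_card (subsetIl _ _)).
  by rewrite (card_flats Xs) leq_exp2l // (q_gt1 F).
exists (s - t), X; rewrite subnKC //; split=> // s' S s's Ss'.
have nP : ~~ P s' by apply: contraTN s's => /mins; rewrite leqNgt.
have /exists_inPn/(_ S Ss') := nP.
by case/forall_inPn => B BH; rewrite -ltnNge => ?; exists B.
Qed.

End MaximumPairs.

Theorem theorem1p2 (F : finFieldType) (n k1 k2 t : nat)
    (F1 F2 : {set {set 'rV[F]_n}}) :
  0 < n -> 0 < k1 -> 0 < k2 -> 0 < t ->
  t + 1 <= k2 -> k2 <= k1 -> k1 + k2 + t + 7 <= n ->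
  nontrivial_cross_intersecting k1 k2 t F1 F2 ->
  (forall G1 G2 : {set {set 'rV[F]_n}},
     nontrivial_cross_intersecting k1 k2 t G1 G2 ->
     #|G1| * #|G2| <= #|F1| * #|F2|) ->
  (2 * t < k2 ->
     exists M T : {set 'rV[F]_n},
       [/\ M \in flats (k2 + 1), T \in flats t, T \subset M &
           (F1 = famA1 M T k1 t /\ F2 = famA2 M T k2 t) \/
           [/\ k1 = k2, F1 = famA2 M T k1 t & F2 = famA1 M T k2 t]]) /\
  (k2 <= 2 * t ->
     exists2 S : {set 'rV[F]_n}, S \in flats (t + 1) &
       (F1 = famA3 S k1 /\ F2 = famA4 S k2 t) \/
       [/\ k1 = k2, F1 = famA4 S k1 t & F2 = famA3 S k2]).
Proof.
rewrite !addn1 => n0 _ _ t0 tl lk hn nt maxF.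
have tk : t < k1 by nlia.
have hn' : k2 + k1 + t + 7 <= n by nlia.
pose x0 : 'rV[F]_n := 0%R.
have dims : [/\ 0 <= t <= n, t <= t.+1 <= n, t <= k2.+1 <= n & t <= k1.+1 <= n] by split; nlia.
case: dims => d1 d2 d3 d4.
have nT := setT_flats F n.
have [T0 [T0t _ _]] := flats_between (set1_flats x0) nT (subsetT _) d1.
have [S0 [S0t _ _]] := flats_between T0t nT (subsetT _) d2.
have [M0 [M0l T0M0 _]] := flats_between T0t nT (subsetT _) d3.
have [M1 [M1k T0M1 _]] := flats_between T0t nT (subsetT _) d4.
have nt12 (M T : {set 'rV[F]_n}) := fam12_nontrivial (F := F) t0 tk tl hn (M := M) (T := T).
have nt34 (S : {set 'rV[F]_n}) := fam34_nontrivial (F := F) t0 tk tl hn (S := S).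
have nt12' (M T : {set 'rV[F]_n}) := fam12_nontrivial (F := F) t0 tl tk hn' (M := M) (T := T).
have nt34' (S : {set 'rV[F]_n}) := fam34_nontrivial (F := F) t0 tl tk hn' (S := S).
have max12 M T Ml Tt TM := maxF _ _ (nt12 M T Ml Tt TM).
have max34 S St := maxF _ _ (nt34 S St).
have max12' M T Ml Tt TM := maxF _ _ (nontrivial_sym (nt12' M T Ml Tt TM)).
have max34' S St := maxF _ _ (nontrivial_sym (nt34' S St)).
have lt12 := fam12_lt_fam34 (R := rat) (F := F) t0 tk tl hn.
have lt34 := fam34_lt_fam12 (R := rat) (F := F) t0 tk tl hn.
(* The larger model pair strictly exceeds a natural number, so its product is positive. *)
have pos : 0 < #|F1| * #|F2|.
  have [l2|l2] := leqP k2 (2 * t).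
    exact: leq_trans (leq_ltn_trans (leq0n _) (lt12 _ _ _ M0l T0t T0M0 S0t l2)) (max34 _ S0t).
  exact: leq_trans (leq_ltn_trans (leq0n _) (lt34 _ _ _ M0l T0t T0M0 S0t l2)) (max12 _ _ M0l T0t T0M0).
have [G0 H0] : 0 < #|F1| /\ 0 < #|F2| by apply/andP; rewrite -muln_gt0.
have maxp : maximum_pair k1 k2 t F1 F2 by split.
have maxp' : maximum_pair k2 k1 t F2 F1.
  split; first exact: nontrivial_sym.
  by move=> G' H' /nontrivial_sym /maxF; rewrite mulnC (mulnC #|F2|).
have pos' : 0 < #|F2| * #|F1| by rewrite mulnC.
have [Gk Hl /(cross_intersectingP _ Gk Hl) GH triv] := nt.
have HG B A : B \in F2 -> A \in F1 -> #|F| ^ t <= #|B :&: A| by move=> *; rewrite setIC GH.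
have clG := maximum_closed maxp pos; have clH := maximum_closed maxp' pos'.
have [y [X2 [X2t tyk cH minH]]] := min_cover Gk Hl G0 H0 GH.
have [x [X1 [X1t txl cG minG]]] := min_cover Hl Gk H0 G0 HG.
have all_sub T X (K : {set {set 'rV[F]_n}}) : T \in flats t -> X = T ->
    (forall B, B \in K -> #|F| ^ t <= #|X :&: B|) -> forall B, B \in K -> T \subset B.
  move=> Tt -> h B BK; have := h B BK; rewrite -(card_flats Tt) => hc.
  by apply/setIidPl/eqP; rewrite eqEcard subsetIl.
have [xy|xy] := leqP 2 (x + y).
  have cG' A : A \in F1 -> #|F| ^ t <= #|A :&: X1| by move=> AG; rewrite setIC cG.
  have cH' B : B \in F2 -> #|F| ^ t <= #|B :&: X2| by move=> BH; rewrite setIC cH.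
  have := far_families (R := rat) t0 tk tl hn Gk Hl GH M0l T0t T0M0 X1t X2t tyk txl xy cG' cH' minH minG.
  by rewrite ltnNge max12.
have cases : [\/ x = 0 /\ y = 0, x = 0 /\ y = 1 | x = 1 /\ y = 0].
  by case: x y xy {X1t X2t tyk txl minG minH} => [|[|x]] [|[|y]] //= _; by [constructor 1|constructor 2|constructor 3].
have cover1 (H : {set {set 'rV[F]_n}}) X : X \in flats t.+1 ->
    (forall B, B \in H -> #|F| ^ t <= #|X :&: B|) ->
    X \in [set S in flats t.+1 | [forall B in H, #|F| ^ t <= #|S :&: B|]].
  by move=> Xt h; rewrite in_set Xt; apply/forall_inP.
case: cases => [[x0' y0]|[x0' y1]|[x1 y0]].
- rewrite x0' addn0 in X1t minG; rewrite y0 addn0 in X2t minH.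
  have TG := all_sub _ _ _ X1t erefl cG; have TH := all_sub _ _ _ X2t erefl cH.
  (* All of [F1] contains [X1] and all of [F2] contains [X2]. Closure forces [X1 = X2], since a
     k1-flat through [X2] missing a point of [X1] would belong to [F1]. *)
  case: triv; exists X1 => //; split=> // B BH.
  suff -> : X1 = X2 by apply: TH.
  apply: (flats_sub_eq X1t X2t); apply/subsetP=> z zX1; apply/negPn/negP => zX2.
  have tkn : t <= k1 < n by nlia.
  have [C [Ck XC _ zC]] := flats_avoid X2t nT (subsetT _) (in_setT z) zX2 tkn.
  case/negP: zC; apply: (subsetP (TG _ _)) => //; apply: clG => // B' B'H.
  by rewrite -(card_flats X2t) subset_leq_card // subsetI XC TH.
- rewrite x0' addn0 in X1t minG; rewrite y1 addn1 in X2t minH.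
  have TG := all_sub _ _ _ X1t erefl cG.
  have [allH|/forall_inPn[B0 B0H TB0]] := boolP [forall B in F2, X1 \subset B].
    by case: triv; exists X1 => //; split=> // B BH; apply: (forall_inP allH).
  have := one_center_families (R := rat) t0 tk tl hn Gk Hl GH clG X1t TG B0H TB0
    (cover1 _ _ X2t cH) M0l T0t T0M0.
  case=> [[M [Ml TM GA HA]]|[S [St GA HA]]|]; last by rewrite ltnNge max12.
    have [e1 e2] := subpair_eq GA HA (max12 _ _ Ml X1t TM) pos.
    split=> [_|l2]; first by exists M, X1; split=> //; left.
    have := lt12 _ _ _ Ml X1t TM S0t l2; rewrite -e1 -e2 => h.
    by have := leq_ltn_trans (max34 _ S0t) h; rewrite ltnn.
  have [e1 e2] := subpair_eq GA HA (max34 _ St) pos.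
  split=> [l2|_]; last by exists S => //; left.
  have := lt34 _ _ _ M0l T0t T0M0 St l2; rewrite -e1 -e2 => h.
  by have := leq_ltn_trans (max12 _ _ M0l T0t T0M0) h; rewrite ltnn.
rewrite x1 addn1 in X1t minG; rewrite y0 addn0 in X2t minH.
have TH := all_sub _ _ _ X2t erefl cH.
have [allG|/forall_inPn[A0 A0G TA0]] := boolP [forall A in F1, X2 \subset A].
  by case: triv; exists X2 => //; split=> // A AG; apply: (forall_inP allG).
(* The roles are exchanged here: [F2] has the common t-flat. If k2 < k1, the resulting pair is
   strictly smaller than the unexchanged model, so only k1 = k2 remains. *)
have := one_center_families (R := rat) t0 tl tk hn' Hl Gk HG clH X2t TH A0G TA0
  (cover1 _ _ X1t cG) M1k T0t T0M1.
case=> [[M [Mk TM HA GA]]|[S [St HA GA]]|]; last first.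
- by rewrite ltnNge mulnC (mulnC #|F2|) max12'.
- have [e1 e2] := subpair_eq GA HA (max34' _ St) pos.
  move: lk; rewrite leq_eqVlt => /orP[/eqP ek|lk]; last first.
    have := fam34_swap_lt (R := rat) t0 tk tl hn S0t St lk.
    by rewrite -e1 -e2 mulnC ltnNge max34.
  split=> [l2|_]; last by exists S => //; right; split.
  rewrite ek in l2; have := fam34_lt_fam12 (R := rat) t0 tl tk hn' M1k T0t T0M1 St l2.
  by rewrite -e1 -e2 mulnC (mulnC #|famA1 _ _ _ _|) ltnNge max12'.
have [e1 e2] := subpair_eq GA HA (max12' _ _ Mk X2t TM) pos.
move: lk; rewrite leq_eqVlt => /orP[/eqP ek|lk]; last first.
  have := fam12_swap_lt (R := rat) t0 tk tl hn M0l T0t T0M0 Mk X2t TM lk.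
  by rewrite -e1 -e2 mulnC ltnNge max12.
split=> [_|l2]; first by exists M, X2; split=> //; [rewrite ek | right; split].
rewrite ek in l2; have := fam12_lt_fam34 (R := rat) t0 tl tk hn' Mk X2t TM S0t l2.
by rewrite -e1 -e2 mulnC (mulnC #|famA3 _ _|) ltnNge max34'.
Qed.
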